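(* Let $b\in\mathcal C^\infty(\mathbb R^d,\mathbb R^d)$ be such that $\|\partial^\alpha b\|_\infty<+\infty$ for all multi-indices $\alpha\in\mathbb N^d$ with $|\alpha|\geqslant 1$, let $\Sigma$ be a constant real symmetric positive semi-definite $d\times d$ matrix, and let $(P_t)_{t\geqslant 0}$ be the Markov semigroup of the diffusion $\mathrm dZ_t=b(Z_t)\,\mathrm dt+\Sigma\,\mathrm dW_t$ on $\mathbb R^d$. Let $M$ be a real symmetric positive definite $d\times d$ matrix and $\rho\in\mathbb R$. Then the following propositions are equivalent: (i) For all $z\in\mathbb R^d$, $MJ_b(z)\leqslant -\rho M$. (ii) For all $z_1,z_2\in\mathbb R^d$, if $(Z_{i,t})_{t\geqslant 0}$, $i=1,2$, are the solutions of $\mathrm dZ_t=b(Z_t)\,\mathrm dt+\Sigma\,\mathrm dW_t$ driven by a same Brownian motion $W$ with initial conditions $Z_{i,0}=z_i$, then, almost surely, $$\forall t\geqslant 0,\qquad \|Z_{1,t}-Z_{2,t}\|_M\leqslant e^{-\rho t}\|z_1-z_2\|_M.$$ (iii) For all $\nu,\mu\in\mathcal P(\mathbb R^d)$ and $t\geqslant 0$, $\mathcal W_{M,\infty}(\nu P_t,\mu P_t)\leqslant e^{-\rho t}\mathcal W_{M,\infty}(\nu,\mu)$. (iv) For all $\nu,\mu\in\mathcal P(\mathbb R^d)$ and $t\geqslant 0$, $\mathcal W_{M,1}(\nu P_t,\mu P_t)\leqslant e^{-\rho t}\mathcal W_{M,1}(\nu,\mu)$. (v) For all $f\in\mathcal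 C_{b,L}(\mathbb R^d)$, $t\geqslant 0$ and $z\in\mathbb R^d$, $\|\nabla P_tf(z)\|_{M^{-1}}\leqslant e^{-\rho t}P_t\left(\|\nabla f\|_{M^{-1}}\right)(z)$. (vi) For all $f\in\mathcal C_{b,L}(\mathbb R^d)$ and $t\geqslant 0$, $\|\nabla P_tf\|_{M^{-1},\infty}\leqslant e^{-\rho t}\|\nabla f\|_{M^{-1},\infty}$.
   Context: $W$ is a standard Brownian motion on $\mathbb R^d$; under the assumptions the SDE has a unique strong non-explosive solution for every initial condition. The semigroup is $P_tf(z)=\mathbb E(f(Z_t)\mid Z_0=z)$, and $\nu P_t$ denotes the law of $Z_t$ when $Z_0\sim\nu$. $\mathcal P(\mathbb R^d)$ is the set of probability measures on $\mathbb R^d$ (no moment condition). $J_b(z)=(\partial_{z_j}b_i(z))_{1\leqslant i,j\leqslant d}$ ($i$ the row, $j$ the column) is the Jacobian matrix of $b$. For real square matrices, not necessarily symmetric, $A\leqslant B$ means $x\cdot Ax\leqslant x\cdot Bx$ for all vectors $x$. For $M$ symmetric positive definite, $\|x\|_M=\sqrt{x\cdot Mx}$. For $r\in[1,+\infty]$ and $\nu,\mu\in\mathcal P(\mathbb R^d)$, $\mathcal W_{M,r}(\nu,\mu)=\inf_{\pi\in\Pi(\nu,\mu)}\|\mathrm{dist}_M\|_{L^r(\pi)}$, where $\mathrm{dist}_M(z,y)=\|z-y\|_M$ and $\Pi(\nu,\mu)$ is the set of probability laws on $\mathbb R^d\times\mathbb R^d$ with marginals $\nu$ and $\mu$; the value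 $+\infty$ is allowed. For a function $f$ on $\mathbb R^d$, $$\|\nabla f(z)\|_{M^{-1}}:=\lim_{r\downarrow 0}\ \sup\left\{\frac{|f(z)-f(y)|}{\|y-z\|_M}:\ y\in\mathbb R^d,\ 0<\|z-y\|_M\leqslant r\right\}$$ (which equals $\sqrt{\nabla f(z)\cdot M^{-1}\nabla f(z)}$ if $f$ is differentiable at $z$), and $\|\nabla f\|_{M^{-1},\infty}=\sup\{|f(z)-f(y)|/\|y-z\|_M:\ z,y\in\mathbb R^d,\ z\neq y\}$. $\mathcal C_{b,L}(\mathbb R^d)$ is the set of bounded Lipschitz functions on $\mathbb R^d$. *)

(* Defs.v *)
From HB Require Import structures.
From mathcomp Require Import all_boot all_order all_algebra.
From mathcomp Require Import all_classical all_reals all_analysis.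

Set Implicit Arguments.
Unset Strict Implicit.
Unset Printing Implicit Defensive.
Import Order.TTheory GRing.Theory Num.Theory.
Import numFieldNormedType.Exports.
Local Open Scope classical_set_scope.
Local Open Scope ring_scope.

(* R^d is 'cV[R]_d.  MathComp-Analysis gives it its usual topology (through the
   sup norm) but no sigma-algebra: [borel R d] is the same type with the Borel
   one. *)
Definition borel (R : realType) (d : nat) :=
  g_sigma_algebraType (@open 'cV[R]_d).

Section linear_algebra.
Context {R : realType} {d : nat}.
Implicit Types (M A B : 'M[R]_d) (x y : 'cV[R]_d).

Definition dot x y : R := (x^T *m y) 0 0.

Definition mx_le A B := forall x, dot x (A *m x) <= dot x (B *m x).

Definition sym_posdef M := M^T = M /\ forall x, x != 0 -> 0 < dot x (M *m x).

Definition sym_possemidef M := M^T = M /\ forall x, 0 <= dot x (M *m x).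

Definition normM M x : R := Num.sqrt (dot x (M *m x)).

Definition distM M x y : R := normM M (x - y).

End linear_algebra.

Section derivatives.
Context {R : realType} {d : nat}.

Definition partial {V : normedModType R} (j : 'I_d) (f : 'cV[R]_d -> V)
  : 'cV[R]_d -> V := fun x => 'D_(delta_mx j 0) f x.

Definition smooth {V : normedModType R} (f : 'cV[R]_d -> V) :=
  forall s : seq 'I_d, let g := foldr partial f s in
    continuous g /\ forall j x, derivable g x (delta_mx j 0).

Definition mpartial {V : normedModType R} (alpha : 'I_d -> nat)
    (f : 'cV[R]_d -> V) : 'cV[R]_d -> V :=
  foldr (fun j g => iter (alpha j) (partial j) g) f (enum 'I_d).

Definition bounded_derivatives {V : normedModType R} (f : 'cV[R]_d -> V) :=
  forall alpha : 'I_d -> nat, (1 <= \sum_(j < d) alpha j)%N ->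
    exists C : R, forall x, `|mpartial alpha f x| <= C.

(* Row index: component of b; column index: variable.  This is the transpose
   of the convention of the library's [jacobian]. *)
Definition Jac (b : 'cV[R]_d -> 'cV[R]_d) (z : 'cV[R]_d) : 'M[R]_d :=
  \matrix_(i, j) partial j (fun x => b x i 0 : R) z.

End derivatives.

Section brownian_motion.
Context {R : realType} {d : nat} {dO : measure_display}
  {Omega : measurableType dO}.

Definition independent_increments (P : probability Omega R)
    (W : R -> Omega -> 'cV[R]_d) :=
  forall (n : nat) (t : nat -> R), 0 <= t 0%N ->
    (forall k, (k < n)%N -> t k <= t k.+1) ->
  forall B : 'I_n -> set (borel R d), (forall k, measurable (B k)) ->
    P (\bigcap_(k in [set: 'I_n]) [set w | B k (W (t k.+1) w - W (t k) w)]) =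
    (\prod_(k < n) P [set w | B k (W (t k.+1) w - W (t k) w)%R])%E.

(* W_t - W_s has law N(0, (t - s) I_d): its coordinates are independent and
   N(0, t - s) ([normal_prob] takes the standard deviation). *)
Definition gaussian_increments (P : probability Omega R)
    (W : R -> Omega -> 'cV[R]_d) :=
  forall s t : R, 0 <= s -> s < t ->
  forall A : 'I_d -> set R, (forall i, measurable (A i)) ->
    P (\bigcap_(i in [set: 'I_d]) [set w | A i ((W t w - W s w) i 0)]) =
    (\prod_(i < d) normal_prob 0 (Num.sqrt (t - s)) (A i))%E.

(* Only the times t >= 0 matter. *)
Definition brownian_motion (P : probability Omega R)
    (W : R -> Omega -> 'cV[R]_d) :=
  [/\ forall t : R, 0 <= t ->
        measurable_fun [set: Omega] (W t : Omega -> borel R d),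
      {ae P, forall w, W 0 w = 0},
      forall w, {within `[0, +oo[, continuous (fun t => W t w)},
      independent_increments P W &
      gaussian_increments P W].

End brownian_motion.

Section diffusion.
Context {R : realType} {d : nat} {dO : measure_display}
  {Omega : measurableType dO}.
Variables (b : 'cV[R]_d -> 'cV[R]_d) (Sigma : 'M[R]_d).

(* Since Sigma is constant, the stochastic integral of Sigma against W over
   [0, t] is Sigma (W_t - W_0), so the SDE is an integral equation that makes
   sense path by path: x is a solution started at z and driven by the path w. *)
Definition solves (w : R -> 'cV[R]_d) (z : 'cV[R]_d) (x : R -> 'cV[R]_d) :=
  {within `[0, +oo[, continuous x} /\
  forall t : R, 0 <= t ->
    x t = z + (\col_i \int[lebesgue_measure]_(s in `[0, t]) (b (x s) i 0))
            + Sigma *m (w t - w 0).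

Definition sde_solution (P : probability Omega R) (W : R -> Omega -> 'cV[R]_d)
    (z : 'cV[R]_d) (Z : R -> Omega -> 'cV[R]_d) :=
  (forall t : R, 0 <= t ->
     measurable_fun [set: Omega] (Z t : Omega -> borel R d)) /\
  {ae P, forall w, solves (W ^~ w) z (Z ^~ w)}.

(* The solution Z_t started at z, as a function of the driving path.  When b is
   globally Lipschitz and the path is continuous it exists and is unique on
   t >= 0; outside of that case the value is irrelevant. *)
Definition flow (w : R -> 'cV[R]_d) (z : 'cV[R]_d) : R -> 'cV[R]_d :=
  xget (fun=> 0) [set x | solves w z x].

Variables (P : probability Omega R) (W : R -> Omega -> 'cV[R]_d).

Definition semigroup (t : R) (f : 'cV[R]_d -> R) (z : 'cV[R]_d) : R :=
  \int[P]_w f (flow (W ^~ w) z t).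

Definition semigroup_ereal (t : R) (g : 'cV[R]_d -> \bar R) (z : 'cV[R]_d)
  : \bar R := (\int[P]_w g (flow (W ^~ w) z t))%E.

(* Law of Z_t when Z_0 has law nu and is independent of W: on the product space
   (R^d x Omega, nu \x P) the initial condition is the first projection. *)
Definition law_at (nu : probability (borel R d) R) (t : R)
  : set (borel R d) -> \bar R :=
  pushforward (nu \x P)%E
    (fun zw : borel R d * Omega => flow (W ^~ zw.2) zw.1 t : borel R d).

End diffusion.

Section wasserstein.
Context {R : realType} {d : nat}.

Definition couplings (nu mu : set (borel R d) -> \bar R)
  : set (probability (borel R d * borel R d)%type R) :=
  [set pi | forall A : set (borel R d), measurable A ->
     pi (A `*` setT) = nu A /\ pi (setT `*` A) = mu A].

Definition wasserstein (M : 'M[R]_d) (r : \bar R)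
    (nu mu : set (borel R d) -> \bar R) : \bar R :=
  ereal_inf [set Lnorm pi r
                   (fun zy : borel R d * borel R d => (distM M zy.1 zy.2)%:E)
            | pi in couplings nu mu].

End wasserstein.

Section gradients.
Context {R : realType} {d : nat}.
Implicit Types (M : 'M[R]_d) (f : 'cV[R]_d -> R).

Definition slope M f (z y : 'cV[R]_d) : \bar R :=
  (`|f z - f y| / distM M y z)%:E.

(* ||grad f(z)||_{M^-1}: the lengths of increments are measured with M, which
   gives the dual norm, associated with M^-1, of the gradient. *)
Definition grad_norm M f (z : 'cV[R]_d) : \bar R :=
  lim (ereal_sup [set slope M f z y | y in
         [set y : 'cV[R]_d | 0 < distM M z y <= r]] @[r --> 0^'+]).

(* ||grad f||_{M^-1, oo} *)
Definition grad_norm_sup M f : \bar R :=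
  ereal_sup [set slope M f zy.1 zy.2 | zy in
    [set zy : 'cV[R]_d * 'cV[R]_d | zy.1 != zy.2]].

Definition bounded_lipschitz f :=
  (exists C : R, forall x, `|f x| <= C) /\
  (exists k : R, forall x y, `|f x - f y| <= k * `|x - y|).

End gradients.

(* Main.v *)
Require Import Defs.
From HB Require Import structures.
From mathcomp Require Import all_boot all_order all_algebra.
From mathcomp Require Import all_classical all_reals all_analysis.
From mathcomp Require Import measurable_realfun ess_sup_inf ring lra.

Set Implicit Arguments.
Unset Strict Implicit.
Unset Printing Implicit Defensive.
Import Order.TTheory GRing.Theory Num.Theory.
Import numFieldNormedType.Exports.
Local Open Scope classical_set_scope.
Local Open Scope ring_scope.

(* Since the noise is additive it cancels in the difference of two solutions
   driven by the same path, so that everything is deterministic along a path.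
   (i) amounts to (x - y) . M (b x - b y) <= -rho ||x - y||_M^2 for all x, y;
   then e^(2 rho t) ||Z_(1,t) - Z_(2,t)||_M^2 is nonincreasing along every path,
   and (ii)-(v) follow from this pathwise contraction: for (iii) and (iv) both
   marginals of a coupling are run with the same noise, for (v) difference
   quotients of f along the flow are controlled and dominated convergence applies.
   Conversely (ii)-(v) all imply (vi), by Dirac initial laws for (iii) and (iv) and
   by chaining local slopes along a segment for (v).  Finally, (vi) for truncations
   of the linear form x |-> u . M x gives
     E[u . M (Z_(1,t) - Z_(2,t))] <= e^(-rho t) ||u||_M ||z_1 - z_2||_M,
   and with u = z_1 - z_2 the derivative at t = 0 is the inequality for b above.
   Measurability of the flow comes from Picard iterates, whose integrals are limits
   of Riemann sums. *)

(** * Vectors and the norm ||.||_M *)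

(** Statement (ii) concerns arbitrary solutions, (iii) and (iv) laws, (v) and (vi) expectations
    along [flow]. Since [flow] is an unspecified choice among solutions, nothing can be said about
    it before existence and uniqueness are known path by path. Uniqueness identifies it with an
    explicit limit; measurability is then needed jointly in the starting point and the noise,
    because [law_at] integrates over a product space.

    The contraction estimate is for this reason proved with an arbitrary rate [kappa]. With
    [kappa = -rho] it is the estimate of the theorem. With a crude rate coming from the Lipschitz
    constant of [b] it holds without (i); it then gives uniqueness, and the bounds uniform in the
    noise under which expectations pass to the limit on the way back to (i).

    The truncations are there because (vi) only speaks of bounded functions. Two norms coexist: the
    sup norm carries the topology and the Lipschitz constants, [normM] the estimates. Passing
    between them costs constants that never reach the rate [rho]. *)

Section vectors.
Context {R : realType} {d : nat}.
Implicit Types (x y u v : 'cV[R]_d) (M : 'M[R]_d).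

Lemma normr_coord x i : `|x i 0| <= `|x|.
Proof.
rewrite [leRHS]/Num.Def.normr/= mx_normrE.
exact: (le_bigmax _ (fun ij => `|x ij.1 ij.2|) (i, 0)).
Qed.

Lemma normr_coordB x y i : `|x i 0 - y i 0| <= `|x - y|.
Proof. by have := normr_coord (x - y) i; rewrite !mxE. Qed.

Lemma normr_col_le x e : 0 <= e -> (forall i, `|x i 0| <= e) -> `|x| <= e.
Proof.
move=> e0 xe; rewrite [leLHS]/Num.Def.normr/= mx_normrE.
by apply: bigmax_le => // -[i j] _ /=; rewrite (ord1 j).
Qed.

Lemma normr_col_lt x e : 0 < e -> (forall i, `|x i 0| < e) -> `|x| < e.
Proof.
move=> e0 xe; rewrite [ltLHS]/Num.Def.normr/= mx_normrE.
by apply: bigmax_lt => // -[i j] _ /=; rewrite (ord1 j).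
Qed.

Lemma dotE x y : dot x y = \sum_i x i 0 * y i 0.
Proof. by rewrite /dot mxE; apply: eq_bigr => i _; rewrite mxE. Qed.

Lemma dotC x y : dot x y = dot y x.
Proof. by rewrite !dotE; apply: eq_bigr => i _; rewrite mulrC. Qed.

Lemma dotDr x y v : dot x (y + v) = dot x y + dot x v.
Proof. by rewrite /dot mulmxDr mxE. Qed.

Lemma dotZl a x y : dot (a *: x) y = a * dot x y.
Proof. by rewrite /dot linearZ/= -scalemxAl mxE. Qed.

Lemma dotZr a x y : dot x (a *: y) = a * dot x y.
Proof. by rewrite /dot -scalemxAr mxE. Qed.

Lemma dot0r x : dot x 0 = 0.
Proof. by rewrite /dot mulmx0 mxE. Qed.

Lemma dotNr x y : dot x (- y) = - dot x y.
Proof. by rewrite -scaleN1r dotZr mulN1r. Qed.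

Lemma dotBr x y v : dot x (y - v) = dot x y - dot x v.
Proof. by rewrite dotDr dotNr. Qed.

Lemma dotBl x y v : dot (x - y) v = dot x v - dot y v.
Proof. by rewrite dotC dotBr ![dot v _]dotC. Qed.

Lemma dot_sym M x y : M^T = M -> dot x (M *m y) = dot y (M *m x).
Proof.
move=> MT; by rewrite [RHS]dotC /dot trmx_mul MT -mulmxA.
Qed.

Lemma dot_delta i x : dot (delta_mx i 0) x = x i 0.
Proof.
rewrite dotE (bigD1 i)//= !mxE !eqxx mul1r big1 ?addr0// => j ji.
by rewrite mxE (negbTE ji) mul0r.
Qed.

Lemma normr_dot_le x y : `|dot x y| <= d%:R * `|x| * `|y|.
Proof.
rewrite dotE (le_trans (ler_norm_sum _ _ _))//.
rewrite (@le_trans _ _ (\sum_(i < d) `|x| * `|y|))//.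
  by apply: ler_sum => i _; rewrite normrM ler_pM// normr_coord.
by rewrite sumr_const card_ord -[leLHS]mulr_natl mulrA.
Qed.

Lemma sqr_normr_le_dot x : `|x| ^+ 2 <= dot x x.
Proof.
have dot0 : 0 <= dot x x.
  by rewrite dotE sumr_ge0// => i _; rewrite -expr2 sqr_ge0.
rewrite -(sqr_sqrtr dot0) ler_pXn2r ?nnegrE ?sqrtr_ge0//.
apply: normr_col_le => [|i]; first exact: sqrtr_ge0.
rewrite -sqrtr_sqr ler_wsqrtr// dotE (bigD1 i)//= -expr2 lerDl sumr_ge0// => j _.
by rewrite -expr2 sqr_ge0.
Qed.

Lemma coord_col_continuous i : continuous (fun x => x i 0).
Proof. by move=> x; exact: coord_continuous. Qed.

Lemma continuous_coord (T : topologicalType) (f : T -> 'cV[R]_d) :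
  continuous f <-> forall i, continuous (fun t => f t i 0).
Proof.
split=> [cf i t|cf t].
  apply: (@continuous_comp _ _ _ f (fun M : 'cV[R]_d => M i 0)); first exact: cf.
  exact: coord_continuous.
apply/cvgrPdist_le => /= e e0.
have : \forall s \near t, forall i, `|f t i 0 - f s i 0| <= e.
  apply: filter_forall => i.
  by move/cvgrPdist_le: (cf i t) => /(_ _ e0).
apply: filterS => s fs; apply: normr_col_le (ltW e0) _ => i.
by rewrite !mxE.
Qed.

Lemma cvg_sumr (T : Type) (F : set_system T) (FF : Filter F) n
    (f : 'I_n -> T -> R) (a : 'I_n -> R) :
  (forall i, f i t @[t --> F] --> a i) ->
  \sum_i f i t @[t --> F] --> \sum_i a i.
Proof. by move=> fa; apply: cvg_big => //; exact: add_continuous. Qed.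

Lemma continuous_sum (T : topologicalType) n (f : 'I_n -> T -> R) :
  (forall i, continuous (f i)) -> continuous (fun t => \sum_i f i t).
Proof. by move=> cf t; apply: cvg_sumr => i; exact: cf. Qed.

Lemma continuous_mulmx (A : 'M[R]_d) : continuous (fun x => A *m x).
Proof.
apply/continuous_coord => i.
rewrite (_ : (fun _ => _) = (fun x => \sum_j A i j * x j 0)); last first.
  by apply/funext => x; rewrite mxE.
apply: continuous_sum => j x; apply: continuousM; first exact: cst_continuous.
exact: coord_col_continuous.
Qed.

Lemma continuous_dot (T : topologicalType) (f g : T -> 'cV[R]_d) :
  continuous f -> continuous g -> continuous (fun t => dot (f t) (g t)).
Proof.
move=> /continuous_coord cf /continuous_coord cg.
rewrite (_ : (fun _ => _) = (fun t => \sum_j f t j 0 * g t j 0)); last first.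
  by apply/funext => x; rewrite dotE.
by apply: continuous_sum => j x; apply: continuousM; [exact: cf|exact: cg].
Qed.

Lemma continuous_normM M : continuous (normM M).
Proof.
have cdot : continuous (fun x => dot x (M *m x)).
  by apply: continuous_dot => [x|]; [exact: cvg_id|exact: continuous_mulmx].
move=> x; apply: continuous_comp; first exact: cdot.
exact: sqrt_continuous.
Qed.

Lemma normM_le_normr M : exists2 K, 0 <= K & forall x, normM M x <= K * `|x|.
Proof.
pose c := \sum_i \sum_j `|M i j|.
have c0 : 0 <= c by rewrite sumr_ge0// => i _; rewrite sumr_ge0.
have Mx x : `|M *m x| <= c * `|x|.
  apply: normr_col_le => [|i]; first by rewrite mulr_ge0.
  rewrite mxE (le_trans (ler_norm_sum _ _ _))//.
  apply: (@le_trans _ _ ((\sum_j `|M i j|) * `|x|)).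
    rewrite mulr_suml ler_sum// => j _.
    by rewrite normrM ler_wpM2l// normr_coord.
  rewrite ler_wpM2r// /c [leRHS](bigD1 i)//= lerDl sumr_ge0// => j _.
  by rewrite sumr_ge0.
exists (Num.sqrt (d%:R * c)) => [|x]; first exact: sqrtr_ge0.
rewrite -(ger0_norm (normr_ge0 x)) -sqrtr_sqr -sqrtrM ?mulr_ge0// ler_wsqrtr//.
rewrite (le_trans (ler_norm _))// (le_trans (normr_dot_le _ _))//.
rewrite -mulrA -mulrA ler_wpM2l// expr2 mulrCA ler_wpM2l//.
Qed.

Section definite.
Variables (M : 'M[R]_d) (M_pd : sym_posdef M).

Lemma dotM_ge0 x : 0 <= dot x (M *m x).
Proof.
have [->|x0] := eqVneq x 0; last exact/ltW/(proj2 M_pd).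
by rewrite mulmx0 dot0r.
Qed.

Lemma normM_ge0 x : 0 <= normM M x. Proof. exact: sqrtr_ge0. Qed.

Lemma sqr_normM x : normM M x ^+ 2 = dot x (M *m x).
Proof. exact/sqr_sqrtr/dotM_ge0. Qed.

Lemma normM_gt0 x : (0 < normM M x) = (x != 0).
Proof.
have [->|x0] := eqVneq x 0; last by rewrite sqrtr_gt0 (proj2 M_pd).
by rewrite /normM mulmx0 dot0r sqrtr0 ltxx.
Qed.

Lemma normM_eq0 x : (normM M x == 0) = (x == 0).
Proof. by apply: negb_inj; rewrite -normM_gt0 lt0r normM_ge0 andbT. Qed.

Lemma normMZ a x : normM M (a *: x) = `|a| * normM M x.
Proof.
rewrite /normM -scalemxAr dotZl dotZr mulrA -expr2 sqrtrM ?sqr_ge0//.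
by rewrite sqrtr_sqr.
Qed.

Lemma normMN x : normM M (- x) = normM M x.
Proof. by rewrite -scaleN1r normMZ normrN1 mul1r. Qed.

Lemma distMC x y : distM M x y = distM M y x.
Proof. by rewrite /distM -normMN opprB. Qed.

Lemma distM_gt0 x y : (0 < distM M x y) = (x != y).
Proof. by rewrite /distM normM_gt0 subr_eq0. Qed.

(** Cauchy-Schwarz. The form is nonnegative at [(y . M y) x - (x . M y) y], where it equals
    [Y (X Y - a^2)] with [X], [Y], [a] as set below, and [Y > 0]. *)
Lemma normr_dotM_le x y : `|dot x (M *m y)| <= normM M x * normM M y.
Proof.
have [->|y0] := eqVneq y 0.
  by rewrite mulmx0 dot0r normr0 mulr_ge0 ?normM_ge0.
have yy : 0 < dot y (M *m y) by exact: (proj2 M_pd).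
set a := dot x (M *m y).
have := dotM_ge0 (dot y (M *m y) *: x - a *: y).
rewrite mulmxBr -!scalemxAr dotBl !dotBr !dotZl !dotZr.
rewrite (dot_sym y x (proj1 M_pd)) -/a.
set X := dot x _; set Y := dot y _ in yy *.
move=> H; have {}H : a ^+ 2 <= X * Y.
  rewrite -subr_ge0 -(pmulr_rge0 _ yy).
  by apply: (le_trans H); rewrite le_eqVlt; apply/orP; left; apply/eqP; ring.
rewrite -[leLHS]normr_id -ler_sqr ?nnegrE ?mulr_ge0 ?normM_ge0 ?normr_ge0//.
by rewrite normr_id real_normK ?num_real// exprMn !sqr_normM.
Qed.

(** A singular [M] would have a nonzero row [v] with [v M = 0], hence [v M v^T = 0], against
    definiteness. *)
Lemma posdef_unitmx : M \in unitmx.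
Proof.
apply: contraT => Mu; have : \rank M != d.
  by apply: contra Mu => /eqP rM; rewrite -row_full_unit /row_full rM.
move=> rM; have /negP[] : ~~ row_free M by rewrite /row_free.
apply/row_freeP; apply: contrapT => NM.
have : kermx M != 0.
  rewrite -mxrank_eq0 mxrank_ker subn_eq0 -ltnNge ltn_neqAle rM.
  exact: rank_leq_row.
move/rowV0Pn => [v vM v0].
have vM0 : v *m M = 0 by apply/sub_kermxP.
have /(proj2 M_pd) : v^T != 0 by rewrite trmx_eq0.
by rewrite /dot trmxK mulmxA vM0 mul0mx mxE ltxx.
Qed.

(** The coordinate [x_i] is the [M]-inner product of [x] with [M^-1 e_i], which Cauchy-Schwarz
    bounds. The leading 1 keeps [C] positive. *)
Lemma normr_le_normM : exists2 C, 0 < C & forall x, `|x| <= C * normM M x.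
Proof.
pose C := 1 + \sum_i normM M (invmx M *m delta_mx i 0).
have C0 : 0 < C.
  by rewrite ltr_pwDl// sumr_ge0// => i _; exact: normM_ge0.
exists C => // x; apply: normr_col_le => [|i].
  by rewrite mulr_ge0 ?normM_ge0// ltW.
rewrite -dot_delta.
rewrite (_ : dot _ x = dot x (M *m (invmx M *m delta_mx i 0))); last first.
  by rewrite mulKVmx ?posdef_unitmx// dotC.
rewrite (le_trans (normr_dotM_le _ _))// mulrC ler_wpM2r ?normM_ge0//.
rewrite /C (bigD1 i)//= [leRHS]addrCA lerDl addr_ge0// sumr_ge0// => j _.
exact: normM_ge0.
Qed.

End definite.
End vectors.

(** * The drift and its Jacobian *)

Section partial_derivatives.
Context {R : realType} {d : nat}.
Implicit Types (x y u v : 'cV[R]_d).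

Lemma is_derive_line (V : normedModType R) (f : 'cV[R]_d -> V) x v (s : R) :
  derivable f (x + s *: v) v ->
  is_derive s 1 (fun r : R => f (x + r *: v)) ('D_v f (x + s *: v)).
Proof.
have E : (fun h : R => h^-1 *: (((fun r => f (x + r *: v)) \o shift s) (h *: (1 : R))
           - f (x + s *: v))) =
         (fun h : R => h^-1 *: ((f \o shift (x + s *: v)) (h *: v) - f (x + s *: v))).
  apply/funext => h /=; congr (_ *: (f _ - _)).
  by rewrite scalerDl addrCA /GRing.scale/= mulr1.
move=> df; split; first by rewrite /derivable E.
by rewrite /derive E.
Qed.

Variable f : 'cV[R]_d -> R.
Hypothesis df : forall j x, derivable f x (delta_mx j 0).

Lemma partial_MVT x j h : exists2 c, `|c| <= `|h| &
  f (x + h *: delta_mx j 0) - f x = h * partial j f (x + c *: delta_mx j 0).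
Proof.
pose g (s : R) := f (x + s *: delta_mx j 0).
have dg (s : R) : is_derive s 1 g (partial j f (x + s *: delta_mx j 0)).
  exact/is_derive_line.
have cg : continuous g.
  move=> s; apply/differentiable_continuous/derivable1_diffP.
  exact: (@ex_derive _ _ _ _ _ _ _ (dg s)).
have g0 : g 0 = f x by rewrite /g scale0r addr0.
have [h0|h0] := leP 0 h.
  have [c] := MVT_segment h0 (fun s _ => dg s) (continuous_subspaceT cg).
  rewrite in_itv/= => /andP[c0 ch] E; exists c.
    by rewrite !ger0_norm.
  by rewrite -g0 -/(g h) E subr0 mulrC.
have [c] := MVT_segment (ltW h0) (fun s _ => dg s) (continuous_subspaceT cg).
rewrite in_itv/= => /andP[c0 ch] E; exists c.
  by rewrite !ler0_norm ?lerN2// ltW.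
by rewrite -g0 -/(g h) -opprB E sub0r mulrN opprK mulrC.
Qed.

(** Walk from [x] to [y] one coordinate at a time: [hyb k] has its first [k] coordinates from [y]
    and the others from [x], and each step is a one-variable mean value theorem. In the sup norm the
    intermediate points are no further from [x] than [y] is. This stands in for total
    differentiability, since [smooth] speaks of partial derivatives. *)
Lemma increment_partials x y : exists xi : 'I_d -> 'cV[R]_d,
  (forall k, `|xi k - x| <= `|y - x|) /\
  f y - f x = \sum_k (y k 0 - x k 0) * partial k f (xi k).
Proof.
pose hyb (k : nat) := \col_j (if (j < k)%N then y j 0 else x j 0).
have hybS (k : 'I_d) : hyb k.+1 = hyb k + (y k 0 - x k 0) *: delta_mx k 0.
  apply/colP => j; rewrite !mxE ltnS leq_eqVlt eqxx andbT.
  have [->|jk] := eqVneq j k; first by rewrite eqxx ltnn/= mulr1 addrC subrK.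
  by rewrite mulr0 addr0 (negbTE (_ : j != k :> nat)).
have ex (k : 'I_d) : exists xi, `|xi - x| <= `|y - x| /\
    f (hyb k.+1) - f (hyb k) = (y k 0 - x k 0) * partial k f xi.
  have [c cyx E] := partial_MVT (hyb k) k (y k 0 - x k 0).
  exists (hyb k + c *: delta_mx k 0); split; last by rewrite hybS.
  apply: normr_col_le => // j; rewrite !mxE eqxx andbT.
  have [->|jk] := eqVneq j k.
    rewrite ltnn mulr1 addrAC subrr add0r (le_trans cyx)//.
    exact: normr_coordB.
  rewrite mulr0 addr0; case: ifPn => _; last by rewrite subrr normr0.
  exact: normr_coordB.
have [xi xiP] := choice ex; exists xi; split=> [k|]; first by case: (xiP k).
rewrite -(eq_bigr _ (fun k _ => (xiP k).2)).
rewrite -(big_mkord xpredT (fun k => f (hyb k.+1) - f (hyb k))).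
rewrite telescope_sumr//; congr (f _ - f _); apply/colP => j; rewrite !mxE//.
by rewrite ltn_ord.
Qed.

Lemma lipschitz_of_partials (C : R) :
  (forall j x, `|partial j f x| <= C) ->
  forall x y, `|f x - f y| <= d%:R * C * `|x - y|.
Proof.
move=> fC x y; have [xi [_ ->]] := increment_partials y x.
rewrite (le_trans (ler_norm_sum _ _ _))//.
rewrite (@le_trans _ _ (\sum_(i < d) C * `|x - y|))//.
  apply: ler_sum => i _; rewrite normrM mulrC ler_pM//.
  exact: normr_coordB.
by rewrite sumr_const card_ord -[leLHS]mulr_natl mulrA.
Qed.

(** The chain rule along a line: the intermediate points [xi h k] tend to [z] as [h] tends to 0, and
    the partial derivatives are continuous there. *)
Lemma is_derive_dir (cf : forall j, continuous (partial j f)) x v (s : R) :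
  is_derive s 1 (fun r : R => f (x + r *: v))
    (\sum_j v j 0 * partial j f (x + s *: v)).
Proof.
set z := x + s *: v.
have [xi xiP] := choice (fun h : R => increment_partials z (z + h *: v)).
have : (fun h : R => h^-1 *: (((fun r => f (x + r *: v)) \o shift s) (h *: (1 : R))
           - f (x + s *: v))) @ 0^' --> \sum_j v j 0 * partial j f z.
  have xi_cvg k : xi h k @[h --> 0^'] --> z.
    apply/cvgrPdist_lt => /= e e0.
    near=> h; rewrite distrC (le_lt_trans ((xiP h).1 k))//.
    rewrite addrC addKr normrZ.
    rewrite (@le_lt_trans _ _ (`|h| * (`|v| + 1)))//.
      by rewrite ler_wpM2l// lerDl.
    rewrite -ltr_pdivlMr ?ltr_wpDl//.
    by near: h; apply: dnbhs0_lt; rewrite divr_gt0// ltr_wpDl.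
  apply: (@cvg_trans _ ((fun h => \sum_j v j 0 * partial j f (xi h j)) @ 0^')).
    apply: near_eq_cvg; near=> h => /=.
    have h0 : h != 0 by near: h; exact: nbhs_dnbhs_neq.
    rewrite (_ : x + _ = z + h *: v); last first.
      by rewrite scalerDl /GRing.scale/= mulr1 -/(h *: v) addrCA addrC.
    rewrite -/z (xiP h).2 scaler_sumr; apply: eq_bigr => j _.
    by rewrite !mxE [_ + _ - _]addrC addKr /GRing.scale/= !mulrA mulVf// mul1r.
  apply: cvg_sumr => j; apply: cvgM; first exact: cvg_cst.
  exact: (cvg_comp _ _ (xi_cvg j) (cf j z)).
move=> Hc; split; first by apply/cvg_ex; eexists; exact: Hc.
by apply/cvg_lim => //; exact: Hc.
Unshelve. all: by end_near. Qed.

End partial_derivatives.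

Section drift.
Context {R : realType} {d : nat}.
Implicit Types (x y z u v : 'cV[R]_d).

Lemma mpartial1 {V : normedModType R} (f : 'cV[R]_d -> V) (j : 'I_d) :
  mpartial (fun i => (i == j) : nat) f = partial j f.
Proof.
rewrite /mpartial.
suff H (s : seq 'I_d) : uniq s ->
    foldr (fun (i : 'I_d) g => iter (i == j) (partial i) g) f s =
    if j \in s then partial j f else f.
  by rewrite H ?enum_uniq// mem_enum.
elim: s => //= i s IH /andP[si us]; rewrite (IH us) inE eq_sym.
have [<-|//] := eqVneq i j; by rewrite (negbTE si).
Qed.

Variables (b : 'cV[R]_d -> 'cV[R]_d) (b_smooth : smooth b)
  (b_bounded : bounded_derivatives b).

Lemma drift_coord_derivable i j x :
  derivable (fun y => b y i 0 : R) x (delta_mx j 0).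
Proof. by have [_ /(_ j x)/derivable_mxP] := b_smooth [::]; apply. Qed.

Lemma drift_coord_partial i j x :
  partial j (fun y => b y i 0 : R) x = partial j b x i 0.
Proof.
have [_ /(_ j x) db] := b_smooth [::].
by rewrite /partial (derive_mx db) mxE.
Qed.

Lemma drift_coord_partial_continuous i j :
  continuous (partial j (fun y => b y i 0 : R)).
Proof.
rewrite (_ : partial j _ = fun x => partial j b x i 0); last first.
  by apply/funext => x; exact: drift_coord_partial.
by have [/continuous_coord cb _] := b_smooth [:: j]; exact: cb.
Qed.

Lemma drift_continuous : continuous b.
Proof. by have [] := b_smooth [::]. Qed.

Lemma drift_lipschitz : exists2 L, 0 < L & forall x y, `|b x - b y| <= L * `|x - y|.
Proof.
have ex (j : 'I_d) : exists C, forall x, `|partial j b x| <= C.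
  have [|C HC] := b_bounded (alpha := fun i => (i == j) : nat).
    by rewrite (bigD1 j)//= eqxx.
  by exists C => x; rewrite -mpartial1.
have [C HC] := choice ex.
pose K := 1 + \sum_j `|C j|.
have K0 : 0 < K by rewrite ltr_pwDl// sumr_ge0.
have HK i j x : `|partial j (fun y => b y i 0 : R) x| <= K.
  rewrite drift_coord_partial (le_trans (normr_coord _ _))//.
  rewrite (le_trans (HC j x))// (le_trans (ler_norm _))// /K (bigD1 j)//=.
  by rewrite addrCA lerDl addr_ge0// sumr_ge0.
exists (d%:R * K + 1); first by rewrite ltr_wpDl// mulr_ge0// ltW.
move=> x y; apply: normr_col_le => [|i].
  by rewrite mulr_ge0// addr_ge0// mulr_ge0// ltW.
rewrite !mxE (le_trans (lipschitz_of_partials _ (HK i) x y))//.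
  by move=> j z; exact: drift_coord_derivable.
by rewrite ler_wpM2r// lerDl.
Qed.

Lemma is_derive_dot_drift (M : 'M[R]_d) u x v (s : R) :
  is_derive s 1 (fun r : R => dot u (M *m b (x + r *: v)))
    (dot u (M *m Jac b (x + s *: v) *m v)).
Proof.
have db i : is_derive s 1 (fun r : R => b (x + r *: v) i 0)
    ((Jac b (x + s *: v) *m v) i 0).
  rewrite mxE; under eq_bigr => j _ do rewrite mxE mulrC.
  apply: is_derive_dir => j; last exact: drift_coord_partial_continuous.
  by move=> z; exact: drift_coord_derivable.
have E y : dot u (M *m y) = \sum_i (M^T *m u) i 0 * y i 0.
  by rewrite -dotE /dot trmx_mul trmxK mulmxA.
rewrite -mulmxA E; under eq_fun do rewrite E.
rewrite (_ : (fun _ => _) =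
    \sum_i (fun r => (M^T *m u) i 0 *: b (x + r *: v) i 0)); last first.
  by apply/funext => r; rewrite fct_sumE.
by apply: is_derive_sum => i; exact: is_deriveZ.
Qed.

(** Forward, the mean value theorem for [r |-> u . M b(y + r u)] on [[0, 1]], with [u = x - y].
    Backward, the inequality at [z + h v] and [z], divided by [h^2], bounds a difference quotient
    whose limit is [v . M J_b(z) v]. *)
Lemma jacobian_dissipative (M : 'M[R]_d) (M_pd : sym_posdef M) (rho : R) :
  (forall z, mx_le (M *m Jac b z) (- rho *: M)) <->
  (forall x y, dot (x - y) (M *m (b x - b y)) <= - rho * normM M (x - y) ^+ 2).
Proof.
split=> [HJ x y|Hb z v].
  set u := x - y; pose g (r : R) := dot u (M *m b (y + r *: u)).
  have dg (r : R) := is_derive_dot_drift M u y u r.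
  have cg : continuous g.
    move=> r; apply/differentiable_continuous/derivable1_diffP.
    exact: (@ex_derive _ _ _ _ _ _ _ (dg r)).
  have [c _] := MVT_segment ler01 (fun r _ => dg r) (continuous_subspaceT cg).
  have yu : y + u = x by rewrite /u addrCA subrr addr0.
  rewrite /g scale1r scale0r addr0 yu subr0 mulr1.
  move=> E; rewrite mulmxBr dotBr E.
  by have := HJ (y + c *: u) u; rewrite -scalemxAl dotZr -(sqr_normM M_pd).
rewrite -scalemxAl dotZr -(sqr_normM M_pd).
have [dg] := is_derive_dot_drift M v z v 0; rewrite scale0r addr0 => <-.
apply: limr_le => //.
near=> h.
have h0 : h != 0 by near: h; exact: nbhs_dnbhs_neq.
have := Hb (z + h *: v) z.
rewrite /= addrAC subrr add0r normMZ exprMn real_normK ?num_real// addr0.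
rewrite dotZl -dotBr -mulmxBr -!scalerA.
rewrite scale1r scale0r addr0; set D := dot v _ => H.
have h2 : 0 < h ^+ 2 by rewrite exprn_even_gt0.
rewrite -(ler_pM2l h2) /GRing.scale/= [leLHS](_ : _ = h * D); last by field.
by rewrite (le_trans H)// mulrCA.
Unshelve. all: by end_near. Qed.

End drift.

(** * Solutions of the integral equation *)

Section primitives.
Context {R : realType}.
Implicit Types (f g : R -> R) (t T : R).

Definition prim g t : R := \int[lebesgue_measure]_(s in `[0, t]) g s.

Lemma integrable_prim g a t : continuous g ->
  (@lebesgue_measure R).-integrable `[a, t] (EFin \o g).
Proof.
move=> cg; apply: continuous_compact_integrable; first exact: segment_compact.
exact: continuous_subspaceT.
Qed.

Lemma prim0 g : prim g 0 = 0.
Proof. by rewrite /prim set_itv1 Rintegral_set1. Qed.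

Lemma eq_prim f g t : (forall s, 0 <= s <= t -> f s = g s) -> prim f t = prim g t.
Proof.
by move=> fg; apply: eq_Rintegral => s; rewrite inE/= in_itv/= => /fg.
Qed.

Lemma is_derive_prim g t : continuous g -> 0 < t -> is_derive t 1 (prim g) (g t).
Proof.
move=> cg t0.
(* The interval extends to [t + 1] so that [t] is interior. *)
have [dg <-] := @continuous_FTC1_closed R g 0 t (t + 1) (ltr_pwDr ltr01 (lexx _))
  (integrable_prim 0 _ cg) t0 (cg t).
by rewrite derive1E; exact: derivableP.
Qed.

Lemma continuous_prim g T : continuous g -> {within `[0, T], continuous (prim g)}.
Proof.
move=> cg; have [T0|T0] := leP 0 T; last first.
  by rewrite set_itv_ge ?bnd_simp -?ltNge//; exact: continuous_subspace0.
exact: (parameterized_integral_continuous T0 (integrable_prim 0 _ cg)).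
Qed.

(** The mean value theorem for [G - F]. Derivatives are only asked for inside the interval, because
    [prim] is differentiated at positive times only. *)
Lemma increment_le (F G F' G' : R -> R) T : 0 <= T ->
  {within `[0, T], continuous F} -> {within `[0, T], continuous G} ->
  (forall t, 0 < t -> t < T -> is_derive t 1 F (F' t)) ->
  (forall t, 0 < t -> t < T -> is_derive t 1 G (G' t)) ->
  (forall t, 0 < t -> t < T -> F' t <= G' t) ->
  F T - F 0 <= G T - G 0.
Proof.
rewrite le_eqVlt => /predU1P[<- *|T0 cF cG dF dG FG]; first by rewrite !subrr.
have cH : {within `[0, T], continuous (G - F)}.
  by move=> x; apply: continuousD _; [exact: cG|exact/continuousN/cF].
have dH x : x \in `]0, T[%R -> is_derive x 1 (G - F) (G' x - F' x).
  by rewrite in_itv/= => /andP[x0 xT]; apply: is_deriveB; [exact: dG|exact: dF].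
have [c] := MVT T0 dH cH.
rewrite in_itv/= => /andP[c0 cT]; rewrite !fctE => E.
have : 0 <= (G' c - F' c) * (T - 0).
  by rewrite mulr_ge0 ?subr_ge0 ?FG// ltW.
by rewrite -E; lra.
Qed.

(** The bound on the integrands is given as the derivative of an explicit [B], so that no integral
    has to be computed when this is applied. *)
Lemma prim_dist_le (f g B B' : R -> R) t : 0 <= t ->
  continuous f -> continuous g -> (forall s : R, is_derive s 1 B (B' s)) ->
  (forall s, 0 < s -> s < t -> `|f s - g s| <= B' s) ->
  `|prim f t - prim g t| <= B t - B 0.
Proof.
move=> t0 cf cg dB fgB.
have cB : continuous B.
  move=> s; apply/differentiable_continuous/derivable1_diffP.
  exact: (@ex_derive _ _ _ _ _ _ _ (dB s)).
have le (h k : R -> R) : continuous h -> continuous k ->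
    (forall s, 0 < s -> s < t -> h s - k s <= B' s) ->
    prim h t <= prim k t + B t - B 0.
  move=> ch ck hkB.
  have := @increment_le (prim h) (prim k + B) h (fun s => k s + B' s) t t0.
  rewrite !fctE !prim0 subr0 add0r; apply.
  - exact: continuous_prim.
  - move=> s; apply: continuousD; first exact: continuous_prim.
    exact: continuous_subspaceT.
  - by move=> s s0 st; exact: is_derive_prim.
  - by move=> s s0 st; apply: is_deriveD; exact: is_derive_prim.
  - by move=> s s0 st; have := hkB s s0 st; lra.
have := le f g cf cg; have := le g f cg cf; rewrite ler_norml => H1 H2.
apply/andP; split.
  suff: prim g t <= prim f t + B t - B 0 by lra.
  by apply: H1 => s s0 st; have := fgB s s0 st; rewrite ler_norml => /andP[]; lra.
suff: prim f t <= prim g t + B t - B 0 by lra.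
by apply: H2 => s s0 st; have := fgB s s0 st; rewrite ler_norml => /andP[]; lra.
Qed.

(** Freezing the path at time 0 on the left turns continuity on every [[0, T]] into continuity on
    the whole line, the form in which integrands are handled. *)
Lemma continuous_clamp0 (V : normedModType R) (x : R -> V) :
  (forall T, 0 <= T -> {within `[0, T], continuous x}) ->
  continuous (fun t => x (Num.max t 0)).
Proof.
move=> cx t; set s := Num.max t 0.
have s0 : 0 <= s by rewrite le_max lexx orbT.
have cm : continuous (fun t : R => Num.max t 0).
  by move=> r; apply: continuous_max; [exact: cvg_id|exact: cvg_cst].
have /subspace_continuousP /(_ s) := cx (s + 1) (addr_ge0 s0 ler01).
rewrite /= in_itv/= s0 lerDl ler01 => /(_ isT) /cvgrPdist_lt H.
apply/cvgrPdist_lt => e e0.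
have {}H : \forall r \near t, `[0, s + 1]%classic (Num.max r 0) ->
    `|x s - x (Num.max r 0)| < e.
  by have := H _ e0; rewrite near_withinE => /(cm t).
near=> r; apply: (near H r) => //.
rewrite /= in_itv/= le_max lexx orbT/=.
have : `|s - Num.max r 0| < 1.
  by near: r; have /cvgrPdist_lt /(_ 1 ltr01) := cm t.
by rewrite ltr_norml => /andP[]; lra.
Unshelve. all: by end_near. Qed.

Lemma continuous_bounded g T : continuous g -> exists2 K, 0 < K &
  forall t, 0 <= t <= T -> `|g t| <= K.
Proof.
move=> cg; have [T0|T0] := leP 0 T; last first.
  exists 1 => // t /andP[t0 tT]; have := le_lt_trans (le_trans t0 tT) T0.
  by rewrite ltxx.
have cn : continuous (fun t => `|g t|).
  by move=> t; apply: cvg_norm; exact: cg.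
have [c _ Hc] := EVT_max T0 (continuous_subspaceT cn).
exists (`|g c| + 1); first by rewrite ltr_wpDl.
by move=> t t0T; rewrite (le_trans (Hc t _)) ?in_itv// lerDl.
Qed.

(** The mean value theorem writes the average over [[0, 1/(n+1)]] as the value of [g] at some point
    of that segment. *)
Lemma prim_mean_cvg g : continuous g ->
  n.+1%:R * prim g n.+1%:R^-1 @[n --> \oo] --> g 0.
Proof.
move=> cg; apply/cvgrPdist_le => e e0.
have /cvgrPdist_le /(_ _ e0) /nbhs_ballP[r /= r0 gr] := cg 0.
near=> n; have : n.+1%:R^-1 < r.
  by near: n; exact: (near_infty_natSinv_lt (PosNum r0)).
set h := n.+1%:R^-1 => hr.
have h0 : 0 <= h :> R by rewrite invr_ge0.
have [s| |c] := @MVT_segment _ (prim g) g _ _ h0.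
- by rewrite in_itv/= => /andP[s0 _]; exact: is_derive_prim.
- exact: continuous_prim.
rewrite in_itv/= prim0 !subr0 => /andP[c0 ch] ->.
rewrite mulrCA mulfV ?mulr1 ?pnatr_eq0//; apply: gr.
rewrite -ball_normE/= sub0r normrN ger0_norm// (le_lt_trans ch).
Unshelve. all: by end_near. Qed.

End primitives.

Section derivative_of_dot.
Context {R : realType} {d : nat}.

Lemma is_derive_dot (f g f' g' : R -> 'cV[R]_d) (t : R) :
  (forall i, is_derive t 1 (fun s => f s i 0) (f' t i 0)) ->
  (forall i, is_derive t 1 (fun s => g s i 0) (g' t i 0)) ->
  is_derive t 1 (fun s => dot (f s) (g s)) (dot (f t) (g' t) + dot (f' t) (g t)).
Proof.
move=> df dg.
rewrite (_ : (fun _ => _) = \sum_i ((fun s => f s i 0) * (fun s => g s i 0))); last first.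
  by apply/funext => s; rewrite dotE fct_sumE.
rewrite !dotE -big_split/=; apply: is_derive_sum => i.
by apply: is_derive_eq; rewrite /GRing.scale/= [in X in _ + X = _]mulrC.
Qed.

Lemma is_derive_mulmx (M : 'M[R]_d) (f f' : R -> 'cV[R]_d) (t : R) :
  (forall i, is_derive t 1 (fun s => f s i 0) (f' t i 0)) ->
  forall i, is_derive t 1 (fun s => (M *m f s) i 0) ((M *m f' t) i 0).
Proof.
move=> df i; rewrite (_ : (fun _ => _) = \sum_j (fun s => M i j *: f s j 0)); last first.
  by apply/funext => s; rewrite mxE fct_sumE.
by rewrite mxE; apply: is_derive_sum => j; exact: is_deriveZ.
Qed.

End derivative_of_dot.

(** * Pathwise contraction of solutions driven by the same path *)

Section contraction.
Context {R : realType} {d : nat}.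
Variables (b : 'cV[R]_d -> 'cV[R]_d) (b_cont : continuous b) (Sigma : 'M[R]_d).
Implicit Types (w x y : R -> 'cV[R]_d) (z : 'cV[R]_d) (t : R).

Lemma continuous_drift_path y i : continuous y -> continuous (fun s => b (y s) i 0).
Proof.
move=> cy; have /continuous_coord : continuous (b \o y); last exact.
by move=> t; apply: continuous_comp; [exact: cy|exact: b_cont].
Qed.

(** A solution frozen at its initial value for negative times is continuous on the whole line, and
    the equation for [t >= 0] does not see the change. *)
Lemma solves_continuous w z x : solves b Sigma w z x -> exists y,
  [/\ continuous y, forall t, 0 <= t -> y t = x t &
   forall t, 0 <= t -> y t = z + (\col_i prim (fun s => b (y s) i 0) t)
                        + Sigma *m (w t - w 0)].
Proof.
move=> [cx xE]; pose y t := x (Num.max t 0); exists y; split.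
  apply: continuous_clamp0 => T T0; apply: continuous_subspaceW cx => s/=.
  by rewrite !in_itv/= andbT => /andP[].
  by move=> t t0; rewrite /y max_l.
move=> t t0; rewrite /y max_l// xE//; congr (_ + _ + _).
apply/colP => i; rewrite !mxE; apply: eq_prim => s /andP[s0 _].
by rewrite /y max_l.
Qed.

Variables (M : 'M[R]_d) (M_pd : sym_posdef M) (kappa : R).
Hypothesis b_diss : forall x y : 'cV[R]_d,
  dot (x - y) (M *m (b x - b y)) <= kappa * normM M (x - y) ^+ 2.

(* The noise cancels in the difference of two solutions, which is therefore
   differentiable, and [e^(-2 kappa t) ||x_t - y_t||_M^2] is nonincreasing. *)
Lemma solves_contraction w z1 z2 x1 x2 t :
  solves b Sigma w z1 x1 -> solves b Sigma w z2 x2 -> 0 <= t ->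
  normM M (x1 t - x2 t) <= expR (kappa * t) * normM M (z1 - z2).
Proof.
move=> /solves_continuous[y1 [cy1 yx1 y1E]] /solves_continuous[y2 [cy2 yx2 y2E]] t0.
pose D s : 'cV[R]_d := y1 s - y2 s; pose D' s : 'cV[R]_d := b (y1 s) - b (y2 s).
have -> : x1 t - x2 t = D t by rewrite /D yx1 ?yx2.
have D0 : D 0 = z1 - z2.
  rewrite /D y1E// y2E// subrr mulmx0 !addr0.
  by apply/colP => i; rewrite !mxE !prim0 !addr0.
have cD : continuous D by move=> s; apply: continuousB; [exact: cy1|exact: cy2].
have dD (s : R) i : 0 < s -> is_derive s 1 (fun r => D r i 0) (D' s i 0).
  move=> s0; pose E r := (z1 i 0 - z2 i 0) +
    (prim (fun r => b (y1 r) i 0) r - prim (fun r => b (y2 r) i 0) r).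
  apply: (@near_eq_is_derive _ _ _ E).
    near=> r; have r0 : 0 <= r by apply: ltW; near: r; exact: lt_nbhsr.
    by rewrite /D y1E// y2E// /E !mxE; ring.
  have := is_derive_prim (@continuous_drift_path y1 i cy1) s0.
  have := is_derive_prim (@continuous_drift_path y2 i cy2) s0.
  move=> d2 d1; rewrite /E; apply: is_derive_eq.
  by rewrite add0r mul1r /D' !mxE.
pose q s := dot (D s) (M *m D s).
have cq : continuous q.
  apply: continuous_dot => // s; apply: continuous_comp; first exact: cD.
  exact: continuous_mulmx.
pose F s := expR (- (kappa * 2) * s) * q s.
pose F' s := expR (- (kappa * 2) * s) * (dot (D s) (M *m D' s) + dot (D' s) (M *m D s)
  - kappa * 2 * q s).
have cF : continuous F.
  move=> s; rewrite /F.
  apply: (@continuousM R R (fun s : R => expR (- (kappa * 2) * s)) q); last exact: cq.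
  by apply: continuous_comp; [exact: mulrl_continuous|exact: continuous_expR].
have dF s : 0 < s -> s < t -> is_derive s 1 F (F' s).
  move=> s0 _; have dq :=
    @is_derive_dot _ _ D (fun r => M *m D r) D' (fun r => M *m D' r) s (fun i => dD s i s0)
    (is_derive_mulmx M (fun i => dD s i s0)).
  rewrite /F /F'; apply: is_derive_eq.
  by rewrite /GRing.scale/= -/(q s); ring.
have F'0 s : 0 < s -> s < t -> F' s <= 0.
  move=> _ _; rewrite /F' mulr_ge0_le0 ?expR_ge0// (dot_sym (D' s) (D s) (proj1 M_pd)).
  by have := b_diss (y1 s) (y2 s); rewrite sqr_normM// -/(D s) -/(D' s) -/(q s); lra.
have := @increment_le _ F (cst 0) F' (cst 0) t t0 (continuous_subspaceT cF)
  (continuous_subspaceT (@cst_continuous _ _ _)) dF (fun s _ _ => is_derive_cst _ _ _) F'0.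
rewrite /cst subrr subr_le0 /F mulr0 expR0 mul1r => H.
rewrite -ler_sqr ?nnegrE ?mulr_ge0 ?normM_ge0 ?expR_ge0//.
rewrite exprMn !sqr_normM// -D0 -/(q 0) -/(q t).
rewrite mulNr expRN in H.
rewrite -expRM_natr mulrAC mulrC -ler_pdivrMr ?expR_gt0// mulrC.
exact: H.
Unshelve. all: by end_near. Qed.

End contraction.

Section geometric.
Context {R : realType}.

Lemma cvg_half_pow (C : R) : C * 2^-1 ^+ n @[n --> \oo] --> (0 : R).
Proof.
rewrite -[X in _ --> X](mulr0 C); apply: cvgM; first exact: cvg_cst.
by apply: cvg_expr; rewrite ger0_norm ?invr_ge0// invf_lt1// ltr1n.
Qed.

Lemma le_half_pow0 (a C : R) : (forall n, a <= C * 2^-1 ^+ n) -> a <= 0.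
Proof.
move=> aC; rewrite -(cvg_lim _ (cvg_half_pow C))//.
by apply: limr_ge; [apply: cvgP; exact: cvg_half_pow|exact: nearW].
Qed.

(** Nested intervals: [u - 2 C 2^-n] increases, [u + 2 C 2^-n] decreases, and the first stays below
    the second. The supremum of the first lies within [2 C 2^-n] of [u n] for every [n], so it is
    the limit. *)
Lemma geometric_cvg (u : nat -> R) C :
  (forall n, `|u n.+1 - u n| <= C * 2^-1 ^+ n) ->
  forall n, `|lim (u m @[m --> \oo]) - u n| <= 2 * C * 2^-1 ^+ n.
Proof.
move=> uC.
pose h n : R := 2^-1 ^+ n.
have hS n : h n.+1 = h n / 2 by rewrite /h exprSr.
pose v n := u n - 2 * C * h n; pose v' n := u n + 2 * C * h n.
have C0 : 0 <= C by have := uC 0%N; rewrite expr0 mulr1; exact: le_trans.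
have vS : {homo v : m n / (m <= n)%N >-> m <= n}.
  apply/nondecreasing_seqP => n; rewrite /v hS.
  by have := uC n; rewrite ler_norml -/(h n) => /andP[]; lra.
have v'S : {homo v' : m n / (m <= n)%N >-> n <= m}.
  apply/nonincreasing_seqP => n; rewrite /v' hS.
  by have := uC n; rewrite ler_norml -/(h n) => /andP[]; lra.
have vv' m n : v m <= v' n.
  have := vS m (maxn m n) (leq_maxl _ _); have := v'S n (maxn m n) (leq_maxr _ _).
  have : 0 <= 2 * C * h (maxn m n) by rewrite !mulr_ge0// exprn_ge0.
  by rewrite /v /v'; lra.
pose l := sup (range v).
have vl n : v n <= l.
  by apply: ub_le_sup; [exists (v' 0%N) => _ [m _ <-]|exists n].
have lv' n : l <= v' n.
  by apply: ge_sup; [exists (v 0%N), 0%N|move=> _ [m _ <-]].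
have lu n : `|l - u n| <= 2 * C * h n.
  by rewrite ler_norml; have := vl n; have := lv' n; rewrite /v /v'; lra.
suff -> : lim (u m @[m --> \oo]) = l by [].
apply/cvg_lim => //; apply/cvgrPdist_le => e e0.
near=> n; rewrite (le_trans (lu n))//.
apply: (@le_trans _ _ `|0 - 2 * C * 2^-1 ^+ n|).
  by rewrite sub0r normrN ler_norm.
by near: n; have /cvgrPdist_le /(_ _ e0) := cvg_half_pow (2 * C).
Unshelve. all: by end_near. Qed.
End geometric.

(** * Existence of solutions by Picard iteration *)

Section picard.
Context {R : realType} {d : nat}.
Variables (b : 'cV[R]_d -> 'cV[R]_d) (Sigma : 'M[R]_d).
Implicit Types (w x y : R -> 'cV[R]_d) (z : 'cV[R]_d) (t T : R).

(* Times are clamped to [0, +oo[ so that the iterates are continuous on the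
   whole line. *)
Fixpoint picard w z (n : nat) t : 'cV[R]_d :=
  if n is m.+1 then
    z + (\col_i prim (fun s => b (picard w z m s) i 0) (Num.max t 0))
      + Sigma *m (w (Num.max t 0) - w 0)
  else z.

Definition picard_lim w z t : 'cV[R]_d :=
  \col_i lim (picard w z n t i 0 @[n --> \oo]).

Hypothesis b_cont : continuous b.
Variable (L : R).
Hypothesis L0 : 0 < L.
Hypothesis b_lip : forall x y : 'cV[R]_d, `|b x - b y| <= L * `|x - y|.
Variables (w : R -> 'cV[R]_d) (w_cont : {within `[0, +oo[, continuous w}).

Lemma continuous_picard z n : continuous (picard w z n).
Proof.
elim: n => [|n IH]; first by move=> t; exact: cvg_cst.
have cw : continuous (fun t => w (Num.max t 0)).
  apply: continuous_clamp0 => T T0; apply: continuous_subspaceW w_cont => s/=.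
  by rewrite !in_itv/= andbT => /andP[].
have c1 : continuous
    (fun t => \col_i prim (fun s => b (picard w z n s) i 0) (Num.max t 0)).
  apply/continuous_coord => i; under eq_fun do rewrite mxE.
  apply: continuous_clamp0 => T T0; apply: continuous_prim.
  exact: continuous_drift_path.
have c2 : continuous (fun t => Sigma *m (w (Num.max t 0) - w 0)).
  move=> t; apply: (@continuous_comp _ _ _ (fun t => w (Num.max t 0) - w 0)).
    by apply: continuousB; [exact: cw|exact: cvg_cst].
  exact: continuous_mulmx.
by move=> t; exact: (cvgD (cvgD (cvg_cst z) (c1 t)) (c2 t)).
Qed.

(** For the weight [e^(2 L t)] the Picard map contracts by 1/2: the integral of [L K 2^-n e^(2 L s)]
    over [[0, t]] is at most [K 2^-(n+1) e^(2 L t)]. On [[0, T]] the weight goes into the constant,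
    so [T] need not be small. *)
Lemma picard_step z T : 0 <= T -> exists C, forall t n, 0 <= t <= T ->
  `|picard w z n.+1 t - picard w z n t| <= C * 2^-1 ^+ n.
Proof.
move=> T0; have cn : continuous (fun t => `|picard w z 1 t - picard w z 0 t|).
  move=> t; apply: cvg_norm; apply: continuousB; exact: continuous_picard.
have [K K0 HK] := continuous_bounded T cn.
have H n : forall t, 0 <= t <= T -> `|picard w z n.+1 t - picard w z n t|
    <= K * 2^-1 ^+ n * expR (2 * L * t).
  elim: n => [|n IH] t /[dup] tT /andP[t0 tT'].
    rewrite expr0 mulr1 (le_trans (le_trans (ler_norm _) (HK t tT)))//.
    by rewrite ler_peMr ?(ltW K0)// -expR0 ler_expR !mulr_ge0// ltW.
  set B : R -> R := fun s => K * 2^-1 ^+ n.+1 * expR (2 * L * s).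
  set B' : R -> R := fun s => L * (K * 2^-1 ^+ n * expR (2 * L * s)).
  have B0 s : 0 <= B s by rewrite !mulr_ge0 ?exprn_ge0 ?expR_ge0// ltW.
  have dB (s : R) : is_derive s 1 B (B' s).
    by rewrite /B /B'; apply: is_derive_eq; rewrite /GRing.scale/= exprS; field.
  apply: normr_col_le => [|i]; first exact: B0.
  pose g m s := b (picard w z m s) i 0.
  have cg m : continuous (g m) by apply: continuous_drift_path => //; exact: continuous_picard.
  rewrite !mxE !max_l// -/(g _) -/(g n.+1) -/(g n).
  rewrite (_ : _ - _ = prim (g n.+1) t - prim (g n) t); last by rewrite /g/=; ring.
  apply: (@le_trans _ _ (B t - B 0)); last by rewrite gerBl.
  apply: prim_dist_le (cg _) (cg _) dB _ => // s s0 st.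
  rewrite (le_trans (normr_coordB _ _ _))// (le_trans (b_lip _ _))// ler_pM2l//.
  by apply: IH; rewrite (ltW s0) (ltW (lt_le_trans st tT')).
exists (K * expR (2 * L * T)) => t n tT; rewrite (le_trans (H n t tT))//.
rewrite mulrAC ler_wpM2r ?exprn_ge0// ler_wpM2l ?(ltW K0)// ler_expR.
by rewrite ler_wpM2l ?mulr_ge0 ?(ltW L0)//; case/andP: tT.
Qed.

Lemma picard_clamp0 z n t : picard w z n t = picard w z n (Num.max t 0).
Proof. by case: n => //= n; rewrite [Num.max (Num.max t 0) 0]max_l// le_max lexx orbT. Qed.

Lemma picard_lim_dist z T : 0 <= T -> exists C, forall t n, t <= T ->
  `|picard_lim w z t - picard w z n t| <= C * 2^-1 ^+ n.
Proof.
move=> T0; have [C HC] := picard_step z T0.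
have C0 : 0 <= C.
  by have := HC 0 0%N; rewrite lexx T0 expr0 mulr1 => /(_ isT); exact: le_trans.
exists (2 * C) => t n tT; apply: normr_col_le => [|i].
  by rewrite !mulr_ge0// exprn_ge0.
rewrite !mxE; apply: (geometric_cvg (u := fun m => picard w z m t i 0)) => m.
have := HC (Num.max t 0) m; rewrite le_max lexx orbT ge_max tT T0 => /(_ isT).
by rewrite -!picard_clamp0; apply: le_trans; exact: normr_coordB.
Qed.

(** The iterates converge uniformly on []-oo, |t| + 1]]; the rest is an [e / 3] argument. *)
Lemma continuous_picard_lim z : continuous (picard_lim w z).
Proof.
move=> t; apply/cvgrPdist_le => e e0.
have T0 : 0 <= `|t| + 1 by rewrite addr_ge0.
have [C HC] := picard_lim_dist z T0.
have e3 : 0 < e / 3 by rewrite divr_gt0.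
have [n Hn] : exists n, C * 2^-1 ^+ n <= e / 3.
  have /cvgrPdist_le /(_ _ e3) [n _ /(_ n (leqnn n))] := cvg_half_pow C.
  by rewrite /= sub0r normrN => ?; exists n; rewrite (le_trans (ler_norm _)).
have /cvgrPdist_le /(_ _ e3) H := @continuous_picard z n t.
near=> s.
have d1 := HC t n (le_trans (ler_norm t) (ler_wpDr ler01 (lexx _))).
have sT : s <= `|t| + 1.
  have : `|t - s| <= 1.
    by near: s; have /cvgrPdist_le /(_ 1 ltr01) := (@cvg_id _ (nbhs t)).
  by rewrite ler_norml; have := ler_norm t; lra.
have d2 := HC s n sT.
have d3 : `|picard w z n t - picard w z n s| <= e / 3 by near: s.
have -> : picard_lim w z t - picard_lim w z s =
  (picard_lim w z t - picard w z n t) + (picard w z n t - picard w z n s)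
  - (picard_lim w z s - picard w z n s).
  by rewrite subrKA opprB subrKA.
rewrite (le_trans (ler_normB _ _))//.
have := ler_normD (picard_lim w z t - picard w z n t) (picard w z n t - picard w z n s).
by lra.
Unshelve. all: by end_near. Qed.

(** Comparison with the identity that defines iterate [n + 1] bounds the defect of the limit in the
    integral equation by [(C + L C t) 2^-n], for every [n]. *)
Lemma picard_lim_solves z : solves b Sigma w z (picard_lim w z).
Proof.
split; first exact/continuous_subspaceT/continuous_picard_lim.
move=> t t0; apply/eqP; rewrite -subr_eq0 -normr_le0.
set X := picard_lim w z.
change (`|X t - (z + (\col_i prim (fun s => b (X s) i 0) t) + Sigma *m (w t - w 0))| <= 0).
have [C HC] := picard_lim_dist z t0.
have C0 : 0 <= C.
  by have := HC 0 0%N t0; rewrite expr0 mulr1; exact: le_trans.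
apply: (@le_half_pow0 _ _ (C + L * C * t)) => n; apply: normr_col_le => [|i].
  by rewrite mulr_ge0 ?exprn_ge0// addr_ge0// !mulr_ge0// ltW.
set g := fun s => b (X s) i 0; set gn := fun s => b (picard w z n s) i 0.
have h1 : `|X t i 0 - picard w z n.+1 t i 0| <= C * 2^-1 ^+ n.
  rewrite (le_trans (normr_coordB _ _ _))// (le_trans (HC t n.+1 (lexx t)))//.
  rewrite exprS ler_wpM2l// ler_piMl ?exprn_ge0//.
  by rewrite invf_le1 ?ler1n.
have h2 : `|prim gn t - prim g t| <= L * C * 2^-1 ^+ n * t.
  have := @prim_dist_le _ gn g (fun s => L * C * 2^-1 ^+ n * s)
    (cst (L * C * 2^-1 ^+ n)) t t0.
  rewrite mulr0 subr0; apply.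
  - by apply: continuous_drift_path => //; exact: continuous_picard.
  - by apply: continuous_drift_path => //; exact: continuous_picard_lim.
  - by move=> s; apply: is_derive_eq; rewrite /GRing.scale/= mulr1.
  - move=> s s0 st.
    rewrite (le_trans (normr_coordB _ _ _))// (le_trans (b_lip _ _))//.
    by rewrite -mulrA ler_pM2l// distrC HC// ltW.
have -> : (X t - (z + (\col_i prim (fun s => b (X s) i 0) t) + Sigma *m (w t - w 0))) i 0
    = (X t i 0 - picard w z n.+1 t i 0) + (prim gn t - prim g t).
  by rewrite /= (max_l t0) ![in LHS]mxE ![in RHS]mxE -/g -/gn; ring.
rewrite (le_trans (ler_normD _ _))// mulrDl lerD//.
by rewrite (le_trans h2)// mulrAC.
Qed.

End picard.

(** * Measurability of the flow *)

Section borel_vectors.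
Context {R : realType} {d : nat}.

Lemma continuous_measurable_borel (h : 'cV[R]_d -> R) : continuous h ->
  measurable_fun [set: borel R d] (h : borel R d -> R).
Proof.
move=> ch; apply: (measurability _ (RGenOInfty.measurableE R)).
move=> _ [_ [a ->] <-]; rewrite setTI; apply: sub_sigma_algebra.
by have /continuousP := ch; apply; exact: interval_open.
Qed.

Context {dT : measure_display} {T : measurableType dT}.
Implicit Types f g : T -> borel R d.

(** An open set is the countable union of the rational boxes that it contains. [F k] is the preimage
    of the box coded by [k], and empty when [k] codes no box inside [U]; the preimage of a box only
    involves coordinates. *)
Lemma measurable_borelP f :
  measurable_fun setT f <-> forall i, measurable_fun setT (fun t => f t i 0 : R).
Proof.
split=> [mf i|mf].
  apply: (measurableT_comp (f := fun x : borel R d => x i 0 : R)) => //.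
  have H := continuous_measurable_borel (@coord_col_continuous R d i).
  exact: H.
apply: (@measurability _ _ T (borel R d) setT f (@open _) erefl) => _ [U oU <-].
rewrite setTI.
pose box (q : 'cV[rat]_d) (n : nat) : set 'cV[R]_d :=
  [set y | forall i, `|y i 0 - ratr (q i 0)| < n.+1%:R^-1].
pose F (k : nat) : set T := if unpickle k is Some (q, n)
  then (if `[< box q n `<=` U >] then f @^-1` box q n else set0) else set0.
rewrite [X in measurable X](_ : _ = \bigcup_k F k).
  apply: bigcupT_measurable => k; rewrite /F.
  case: unpickle => [[q n]|//]; case: ifPn => // _.
  rewrite (_ : _ @^-1` _ = \bigcap_(i in [set: 'I_d])
     (setT `&` (fun t => f t i 0) @^-1`
       `](ratr (q i 0) - n.+1%:R^-1), (ratr (q i 0) + n.+1%:R^-1)[%classic)).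
    by apply: fin_bigcap_measurable => // i _; apply: mf.
  apply/seteqP; split=> t.
    by move=> /= ft i _; split=> //=; rewrite in_itv/= -ltr_distl.
  by move=> ft i; have [_] := ft i I; rewrite /= in_itv/= -ltr_distl.
apply/seteqP; split=> [t /= Uft|t [k _]]; last first.
  rewrite /F; case: unpickle => [[q n]|//]; case: ifPn => // /asboolP qU.
  exact: qU.
have /nbhs_ballP[e /= e0 eU] : nbhs (f t : 'cV[R]_d) U by exact: open_nbhs_nbhs.
have [n ne] : exists n : nat, n.+1%:R^-1 < e / 2.
  have e2 : 0 < e / 2 by rewrite divr_gt0.
  have [n _ /(_ n (leqnn n))] := near_infty_natSinv_lt (PosNum e2).
  by exists n.
have n0 : 0 < n.+1%:R^-1 :> R by rewrite invr_gt0.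
have ex i : exists q : rat, `|f t i 0 - ratr q| < n.+1%:R^-1.
  have /rat_in_itvoo[q] : f t i 0 - n.+1%:R^-1 < f t i 0 + n.+1%:R^-1.
    by rewrite ltrD2l; apply: (@lt_trans _ _ 0) => //; rewrite oppr_lt0.
  by rewrite in_itv/= -ltr_distl distrC => qf; exists q.
have [q qP] := choice ex.
exists (pickle (\col_i q i, n)) => //; rewrite /F pickleK; case: ifPn.
  by move=> _ i; rewrite mxE.
case/asboolPn => y yq; apply: eU; rewrite -ball_normE /=.
apply: normr_col_lt => // i; rewrite !mxE.
have := yq i; rewrite mxE => yqi.
have := ler_distD (ratr (q i)) (f t i 0) (y i 0); rewrite [`|ratr _ - y _ _|]distrC.
by move=> /le_lt_trans; apply; rewrite (splitr e) ltrD//; apply: lt_trans ne.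
Qed.

Lemma measurable_borel_comp (h : 'cV[R]_d -> R) f : continuous h ->
  measurable_fun setT f -> measurable_fun setT (fun t => h (f t) : R).
Proof.
move=> ch mf; apply: (measurableT_comp (f := h : borel R d -> R)) => //.
exact: continuous_measurable_borel.
Qed.

Lemma measurable_borelD f g : measurable_fun setT f -> measurable_fun setT g ->
  measurable_fun setT (fun t => (f t : 'cV[R]_d) + g t : borel R d).
Proof.
move=> /measurable_borelP mf /measurable_borelP mg; apply/measurable_borelP => i.
by under eq_fun do rewrite mxE; exact: measurable_funD.
Qed.

Lemma measurable_borelB f g : measurable_fun setT f -> measurable_fun setT g ->
  measurable_fun setT (fun t => (f t : 'cV[R]_d) - g t : borel R d).
Proof.
move=> /measurable_borelP mf /measurable_borelP mg; apply/measurable_borelP => i.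
by under eq_fun do rewrite !mxE; exact: measurable_funB.
Qed.

End borel_vectors.

Section riemann_sums.
Context {R : realType}.
Implicit Types (g : R -> R) (t : R).

(** Heine-Cantor on [[0, t]], from the covering form of compactness; [r] may leave the segment. *)
Lemma near_uniformly_close g t (e : R) : continuous g -> 0 <= t -> 0 < e ->
  \forall n \near \oo, forall s, 0 <= s <= t ->
    forall r, `|s - r| <= t * n.+1%:R^-1 -> `|g s - g r| <= e.
Proof.
move=> cg t0 e0.
have h0 : t * n.+1%:R^-1 @[n --> \oo] --> (0 : R).
  rewrite -[X in _ --> X](mulr0 t); apply: cvgM; first exact: cvg_cst.
  exact: cvg_harmonic.
have K := @segment_compact R 0 t.
have := (compact_near_coveringP _).1 K nat \oo
  (fun n s => forall r, `|s - r| <= t * n.+1%:R^-1 -> `|g s - g r| <= e) _.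
have He s : `[0, t]%classic s ->
    \forall s' \near s & n \near \oo, forall r,
      `|s' - r| <= t * n.+1%:R^-1 -> `|g s' - g r| <= e.
  move=> _; have e2 : 0 < e / 2 by rewrite divr_gt0.
  have /cvgrPdist_le /(_ _ e2) := cg s; move=> /nbhs_ballP[d /= d0 sd].
  have d2 : 0 < d / 2 by rewrite divr_gt0.
  near=> s' n => r s'r.
  have ss' : `|s - s'| < d / 2 by near: s'; apply/nbhs_ballP; exists (d / 2).
  have hn : t * n.+1%:R^-1 < d / 2.
    have : `|0 - t * n.+1%:R^-1| < d / 2.
      by near: n; have /cvgrPdist_lt /(_ _ d2) := h0.
    by rewrite sub0r normrN; exact: le_lt_trans (ler_norm _).
  have gs' : `|g s - g s'| <= e / 2.
    apply: sd; rewrite -ball_normE/= (lt_le_trans ss')//.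
    by rewrite ler_pdivrMr// ler_peMr ?ler1n// ltW.
  have gr : `|g s - g r| <= e / 2.
    apply: sd; rewrite -ball_normE/=.
    rewrite (le_lt_trans (ler_distD s' _ _))// (splitr d) ltrD//.
    exact: le_lt_trans hn.
  rewrite (le_trans (ler_distD (g s) _ _))// (splitr e) lerD// distrC//.
by move=> /(_ _ He) [n _ Hn]; exists n => // m nm s sT r;
  apply: (Hn m nm s); rewrite /= in_itv.
Unshelve. all: by end_near. Qed.

(** [prim g t] telescopes over cells of length [h]; on each one the mean value theorem gives
    [h g(c)], and uniform continuity compares [g(c)] with the value at the left end. The tolerance
    [e / (t + 1)] absorbs the total length and remains meaningful for [t = 0]. *)
Lemma riemann_sum_cvg g t : continuous g -> 0 <= t ->
  t * n.+1%:R^-1 * (\sum_(k < n.+1) g (t * n.+1%:R^-1 * k%:R)) @[n --> \oo]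
    --> prim g t.
Proof.
move=> cg t0; apply/cvgrPdist_le => e e0.
have e1 : 0 < e / (t + 1) by rewrite divr_gt0// ltr_wpDl.
have := near_uniformly_close cg t0 e1; apply: filterS => n Hn.
set h := t * n.+1%:R^-1.
have h0 : 0 <= h by rewrite mulr_ge0.
have hn : h * n.+1%:R = t by rewrite /h mulfVK// pnatr_eq0.
have -> : prim g t = \sum_(k < n.+1) (prim g (h * k.+1%:R) - prim g (h * k%:R)).
  rewrite -(big_mkord xpredT (fun k => prim g (h * k.+1%:R) - prim g (h * k%:R))).
  by rewrite (telescope_sumr (fun k => prim g (h * k%:R)))// hn mulr0 prim0 subr0.
rewrite mulr_sumr -sumrB (le_trans (ler_norm_sum _ _ _))//.
apply: (@le_trans _ _ (\sum_(k < n.+1) h * (e / (t + 1)))).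
  apply: ler_sum => k _.
  have ab : h * k%:R <= h * k.+1%:R by rewrite ler_wpM2l// ler_nat.
  have a0 : 0 <= h * k%:R by rewrite mulr_ge0.
  have bt : h * k.+1%:R <= t by rewrite -hn ler_wpM2l// ler_nat ltn_ord.
  have := @MVT_segment _ (prim g) g _ _ ab.
  case=> [s| |c].
  - rewrite in_itv/= => /andP[as_ _]; apply: is_derive_prim => //.
    exact: le_lt_trans as_.
  - apply: (continuous_subspaceW _ (@continuous_prim _ g t cg)) => s /=.
    rewrite !in_itv/= => /andP[as_ sb].
    by rewrite (le_trans a0 as_) (le_trans sb bt).
  rewrite in_itv/= => /andP[ac cb] ->.
  have hb : h * k.+1%:R - h * k%:R = h by rewrite -mulrBr -natrB// subSnn mulr1.
  rewrite hb [g c * h]mulrC -mulrBr normrM ger0_norm// ler_wpM2l//.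
  apply: Hn; first by rewrite (le_trans a0 ac) (le_trans cb bt).
  by rewrite ger0_norm ?subr_ge0// -/h -[leRHS]hb lerB.
rewrite sumr_const card_ord -[leLHS]mulr_natr mulrAC hn mulrA ler_pdivrMr ?ltr_wpDl//.
by rewrite mulrC ler_wpM2l ?(ltW e0)// lerDl.
Qed.

End riemann_sums.

(** * Uniqueness, and joint measurability of the flow *)

Section flow.
Context {R : realType} {d : nat}.
Variables (b : 'cV[R]_d -> 'cV[R]_d) (Sigma : 'M[R]_d) (b_cont : continuous b).
Variable L : R.
Hypotheses (L0 : 0 < L)
  (b_lip : forall x y : 'cV[R]_d, `|b x - b y| <= L * `|x - y|).

(** The rate is the Lipschitz constant times the two constants of norm equivalence: crude, but
    available for every [M] without (i). *)
Lemma lipschitz_dissipative (M : 'M[R]_d) (M_pd : sym_posdef M) : exists kappa : R,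
  forall x y, dot (x - y) (M *m (b x - b y)) <= kappa * normM M (x - y) ^+ 2.
Proof.
have [C C0 HC] := normr_le_normM M_pd.
have [K K0 HK] := normM_le_normr M.
exists (K * (L * C)) => x y; rewrite (le_trans (ler_norm _))//.
rewrite (le_trans (normr_dotM_le M_pd _ _))// expr2 mulrCA ler_wpM2l ?normM_ge0//.
rewrite (le_trans (HK _))// -!mulrA ler_wpM2l// (le_trans (b_lip _ _))//.
by rewrite ler_pM2l.
Qed.

Section path.
Variables (w : R -> 'cV[R]_d) (w_cont : {within `[0, +oo[, continuous w}).

Lemma flow_solves z : solves b Sigma w z (flow b Sigma w z).
Proof.
apply: (@xgetPex _ (fun=> 0) [set x | solves b Sigma w z x]).
exists (picard_lim b Sigma w z) => /=.
exact: (picard_lim_solves _ b_cont L0 b_lip w_cont).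
Qed.

Lemma sym_posdef1 : sym_posdef (1%:M : 'M[R]_d).
Proof.
split=> [|x x0]; first exact: trmx1.
rewrite mul1mx; apply: lt_le_trans (sqr_normr_le_dot x).
by rewrite exprn_gt0// normr_gt0.
Qed.

(** The contraction estimate with equal initial points, for the Euclidean norm and the crude
    rate. *)
Lemma solves_unique z x t : solves b Sigma w z x -> 0 <= t -> x t = flow b Sigma w z t.
Proof.
move=> sx t0; have [kappa Hk] := lipschitz_dissipative sym_posdef1.
have := solves_contraction b_cont sym_posdef1 Hk sx (flow_solves z) t0.
rewrite subrr (_ : normM _ 0 = 0); last by apply/eqP; rewrite (normM_eq0 sym_posdef1).
rewrite mulr0 => H; apply/eqP; rewrite -subr_eq0 -(normM_eq0 sym_posdef1).
by rewrite eq_le H normM_ge0.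
Qed.

(** Replaces an unspecified choice by an explicit limit, from which measurability can be read
    off. *)
Lemma flow_picard z t : 0 <= t -> flow b Sigma w z t = picard_lim b Sigma w z t.
Proof.
by move=> t0; apply/esym/solves_unique => //; exact: (picard_lim_solves _ b_cont L0 b_lip w_cont).
Qed.

End path.

Context {dO : measure_display} {Omega : measurableType dO}.
Variables (W : R -> Omega -> 'cV[R]_d).
Hypotheses (W_meas : forall t : R, 0 <= t ->
    measurable_fun [set: Omega] (W t : Omega -> borel R d))
  (W_cont : forall w, {within `[0, +oo[, continuous (fun t => W t w)}).

Lemma measurable_picard n (t : R) :
  measurable_fun setT (fun zw : borel R d * Omega =>
    picard b Sigma (W ^~ zw.2) zw.1 n t : borel R d).
Proof.
(* The time stays general, since the Riemann sums sample the previous iterate at other times. *)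
elim: n t => [|n IH] t; first exact: measurable_fst.
set s := Num.max t 0; have s0 : 0 <= s by rewrite le_max lexx orbT.
apply: measurable_borelD; first apply: measurable_borelD.
- exact: measurable_fst.
- apply/measurable_borelP => i; under eq_fun do rewrite mxE.
  apply: (@measurable_fun_cvg _ _ _ _ (fun m (zw : borel R d * Omega) => s * m.+1%:R^-1 *
    (\sum_(k < m.+1) b (picard b Sigma (W ^~ zw.2) zw.1 n (s * m.+1%:R^-1 * k%:R)) i 0))).
    move=> m; apply: measurable_funM; first exact: measurable_cst.
    apply: measurable_sum => k.
    apply: (measurable_borel_comp (h := fun x => b x i 0)); last exact: IH.
    by have /continuous_coord := b_cont; exact.
  move=> [z w] _; apply: riemann_sum_cvg => //.
  apply: continuous_drift_path => //; exact: continuous_picard.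
- have mB : measurable_fun setT (fun zw : borel R d * Omega => W s zw.2 - W 0 zw.2 : borel R d).
    apply: measurable_borelB.
      apply: (measurableT_comp (f := W s : Omega -> borel R d)); first exact: W_meas.
      exact: measurable_snd.
    apply: (measurableT_comp (f := W 0 : Omega -> borel R d)); first exact: W_meas.
    exact: measurable_snd.
  apply/measurable_borelP => i.
  apply: (measurable_borel_comp (h := fun x => (Sigma *m x) i 0)); last exact: mB.
  by have /continuous_coord := @continuous_mulmx R d Sigma; exact.
Qed.

Lemma measurable_flow (t : R) : 0 <= t ->
  measurable_fun setT (fun zw : borel R d * Omega =>
    flow b Sigma (W ^~ zw.2) zw.1 t : borel R d).
Proof.
move=> t0; apply/measurable_borelP => i.
apply: (@measurable_fun_cvg _ _ _ _ (fun n (zw : borel R d * Omega) =>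
    picard b Sigma (W ^~ zw.2) zw.1 n t i 0)).
  by move=> n; have /measurable_borelP := measurable_picard n t; apply.
move=> [z w] _ /=; rewrite (flow_picard (@W_cont w))//.
have [C HC] := picard_lim_dist Sigma b_cont L0 b_lip (@W_cont w) z t0.
apply/cvgrPdist_le => e e0; near=> n.
rewrite (le_trans (normr_coordB _ _ _))// (le_trans (HC t n (lexx t)))//.
apply: (@le_trans _ _ `|0 - C * 2^-1 ^+ n|).
  by rewrite sub0r normrN ler_norm.
by near: n; have /cvgrPdist_le /(_ _ e0) := cvg_half_pow C.
Unshelve. all: by end_near. Qed.

Lemma measurable_flow_path (z : 'cV[R]_d) (t : R) : 0 <= t ->
  measurable_fun setT (fun w => flow b Sigma (W ^~ w) z t : borel R d).
Proof.
move=> t0; have mz : measurable_fun setT (fun w : Omega => (z : borel R d, w)).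
  by apply: measurable_fun_pair; [exact: measurable_cst|exact: measurable_id].
exact: (measurableT_comp (measurable_flow t0) mz).
Qed.

End flow.

(** * From Lipschitz contraction of the semigroup to the drift *)

Section bounded_integrals.
Context {R : realType} {dT : measure_display} {T : measurableType dT}.
Variable (P : probability T R).

Lemma bounded_integrable (h : T -> R) (C : R) : measurable_fun setT h ->
  (forall w, `|h w| <= C) -> P.-integrable setT (EFin \o h).
Proof.
move=> mh hC; apply: measurable_bounded_integrable => //.
  by rewrite [X in (X < _)%E]probability_setT ltry.
exists C; split; first exact: num_real.
by move=> c Cc w _; exact: le_trans (hC w) (ltW Cc).
Qed.

Lemma Rintegral_probability_cst (c : R) : \int[P]_(w in setT) c = c.
Proof. by rewrite Rintegral_cst//= [X in fine X]probability_setT mulr1. Qed.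

Lemma Rintegral_bounded_cvg (h : nat -> T -> R) (h0 : T -> R) (C : R) :
  (forall n, measurable_fun setT (h n)) -> (forall n w, `|h n w| <= C) ->
  (forall w, h n w @[n --> \oo] --> h0 w) ->
  \int[P]_w h n w @[n --> \oo] --> \int[P]_w h0 w.
Proof.
move=> mh hC hh0.
have mh0 : measurable_fun setT h0 by apply: (measurable_fun_cvg mh) => w _; exact: hh0.
have h0C w : `|h0 w| <= C.
  have H : (fun n => `|h n w|) @ \oo --> `|h0 w| by exact: (cvg_norm (hh0 w)).
  rewrite -(cvg_lim _ H)//; apply: limr_le; first exact: (cvgP _ H).
  exact: nearW.
have iC : P.-integrable setT (EFin \o cst C).
  by apply: (@bounded_integrable _ `|C|).
have := @dominated_convergence _ T R P setT measurableT (fun n => EFin \o h n)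
  (EFin \o h0) (EFin \o cst C).
case.
- by move=> n; exact/measurable_EFinP.
- exact/measurable_EFinP.
- by apply: aeW => w _; apply: cvg_EFin; [exact: nearW|exact: hh0].
- exact: iC.
- by apply: aeW => w n _; rewrite /= lee_fin.
by move=> ih0 _ H; apply: fine_cvg; rewrite fineK//; exact: integrable_fin_num.
Qed.

End bounded_integrals.

Lemma lipschitz_fun_continuous {R : realType} (V : normedModType R) (f : V -> R) (k : R) :
  (forall x y, `|f x - f y| <= k * `|x - y|) -> continuous f.
Proof.
move=> fk x; apply/cvgrPdist_le => e e0; near=> y.
rewrite (le_trans (fk _ _))//.
rewrite (@le_trans _ _ ((`|k| + 1) * `|x - y|))//.
  by rewrite ler_wpM2r// (le_trans (ler_norm k))// lerDl.
rewrite mulrC -ler_pdivlMr ?ltr_wpDl//.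
near: y; have e' : 0 < e / (`|k| + 1) by rewrite divr_gt0// ltr_wpDl.
by have /cvgrPdist_le /(_ _ e') := (@cvg_id _ (nbhs x)).
Unshelve. all: by end_near. Qed.

Section gradient_sup.
Context {R : realType} {d : nat}.
Variables (M : 'M[R]_d) (M_pd : sym_posdef M).
Implicit Types (f g : 'cV[R]_d -> R) (x y z : 'cV[R]_d).

Lemma grad_norm_sup_leP f (K : R) : 
  (grad_norm_sup M f <= K%:E)%E ->
  forall x y, x != y -> `|f x - f y| <= K * distM M x y.
Proof.
move=> fK x y xy; rewrite -ler_pdivrMr ?distM_gt0// (distMC M)// -lee_fin.
apply: le_trans fK; apply: ereal_sup_ubound; exists (x, y) => //=.
Qed.

Lemma grad_norm_sup_le f (K : R) :
  (forall x y, x != y -> `|f x - f y| <= K * distM M x y) ->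
  (grad_norm_sup M f <= K%:E)%E.
Proof.
move=> fK; apply: ge_ereal_sup => _ [[x y] /= xy <-].
rewrite /slope lee_fin ler_pdivrMr ?distM_gt0//; last by rewrite eq_sym.
by rewrite -(distMC M) fK.
Qed.

Hypothesis d_gt0 : (0 < d)%N.

(** A positive dimension provides two distinct points, so the supremum runs over a nonempty set and
    is at least 0 instead of [-oo]. Being finite as well, it can be handled as a real number. *)
Lemma bounded_lipschitz_grad_norm_sup f : bounded_lipschitz f ->
  exists2 K, 0 <= K & grad_norm_sup M f = K%:E.
Proof.
move=> [_ [k fk]]; have [C C0 HC] := normr_le_normM M_pd.
have H1 : (grad_norm_sup M f <= (`|k| * C)%:E)%E.
  apply: grad_norm_sup_le => x y _; rewrite (le_trans (fk x y))//.
  rewrite (@le_trans _ _ (`|k| * `|x - y|)) ?ler_wpM2r ?ler_norm//.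
  by rewrite -mulrA ler_wpM2l// HC.
have H0 : (0 <= grad_norm_sup M f)%E.
  have xy : (const_mx 0 : 'cV[R]_d) != const_mx 1.
    apply/eqP => /matrixP /(_ (Ordinal d_gt0) 0); rewrite !mxE => /eqP.
    by rewrite eq_sym oner_eq0.
  apply: (@le_trans _ _ (slope M f (const_mx 0) (const_mx 1))).
    by rewrite /slope lee_fin divr_ge0// normM_ge0.
  by apply: ereal_sup_ubound; exists (const_mx 0, const_mx 1).
exists (fine (grad_norm_sup M f)); first exact: fine_ge0.
by rewrite fineK// ge0_fin_numE// (le_lt_trans H1)// ltry.
Qed.

Lemma bounded_lipschitz_continuous f : bounded_lipschitz f -> continuous f.
Proof. by move=> [_ [k fk]]; exact: lipschitz_fun_continuous fk. Qed.

End gradient_sup.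

Section clamp.
Context {R : realType}.

Definition clamp (n : nat) (r : R) := Num.max (- n%:R) (Num.min r n%:R).

Lemma clamp_bound n r : `|clamp n r| <= n%:R.
Proof.
rewrite /clamp ler_norml le_max lexx/= ge_max ge_min lexx orbT andbT.
by rewrite (@le_trans _ _ 0)// oppr_le0.
Qed.

Lemma clamp_id n r : `|r| <= n%:R -> clamp n r = r.
Proof. by rewrite ler_norml /clamp => /andP[nr rn]; rewrite (min_l rn) (max_r nr). Qed.

Lemma clamp_lipschitz n r s : `|clamp n r - clamp n s| <= `|r - s|.
Proof.
wlog sr : r s / s <= r.
  move=> H; have [/H//|/ltW/H] := leP s r.
  by rewrite distrC [leRHS]distrC.
have n0 : - n%:R <= n%:R :> R by rewrite (@le_trans _ _ 0)// oppr_le0.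
rewrite [leRHS]ger0_norm ?subr_ge0// /clamp.
by have [h1|h1] := leP r n%:R; have [h2|h2] := leP s n%:R;
  have [h3|h3] := leP (- n%:R) r; have [h4|h4] := leP (- n%:R) s;
  rewrite ?(max_l n0) ?(max_r n0) ?ger0_norm; lra.
Qed.

Lemma clamp_cvg r : clamp n r @[n --> \oo] --> r.
Proof.
apply: cvg_near_cst.
near=> n; apply: clamp_id.
by near: n; exact: nbhs_infty_ger.
Unshelve. all: by end_near. Qed.

End clamp.

Section dissipativity.
Context {R : realType} {d : nat}.
Variables (b : 'cV[R]_d -> 'cV[R]_d) (Sigma : 'M[R]_d) (b_cont : continuous b).
Variable L : R.
Hypotheses (L0 : 0 < L)
  (b_lip : forall x y : 'cV[R]_d, `|b x - b y| <= L * `|x - y|).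
Context {dO : measure_display} {Omega : measurableType dO}.
Variables (P : probability Omega R) (W : R -> Omega -> 'cV[R]_d).
Hypotheses (W_meas : forall t : R, 0 <= t ->
    measurable_fun [set: Omega] (W t : Omega -> borel R d))
  (W_cont : forall w, {within `[0, +oo[, continuous (fun t => W t w)}).
Variables (M : 'M[R]_d) (M_pd : sym_posdef M) (rho : R).

Let Z z t w := flow b Sigma (W ^~ w) z t.

(** The crude rate gives a bound uniform in the noise, from which come the dominating constants for
    limits under the expectation. *)
Lemma flow_dist_bound : exists kappa : R, forall x y t w, 0 <= t ->
  normM M (Z x t w - Z y t w) <= expR (kappa * t) * normM M (x - y).
Proof.
have [kappa Hk] := lipschitz_dissipative L0 b_lip M_pd.
exists kappa => x y t w t0.
apply: (solves_contraction b_cont M_pd Hk (w := W ^~ w)) => //;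
  exact: (flow_solves Sigma b_cont L0 b_lip (@W_cont w)).
Qed.

Lemma measurable_flow_fun (h : 'cV[R]_d -> R) z t : continuous h -> 0 <= t ->
  measurable_fun setT (fun w => h (Z z t w)).
Proof.
move=> ch t0; apply: measurable_borel_comp => //.
exact: (measurable_flow_path Sigma b_cont L0 b_lip W_meas W_cont).
Qed.

Lemma integrable_flow_fun (h : 'cV[R]_d -> R) z t : bounded_lipschitz h -> 0 <= t ->
  P.-integrable setT (EFin \o (fun w => h (Z z t w))).
Proof.
move=> hbl t0; have [[C hC] _] := hbl.
apply: (@bounded_integrable _ _ _ _ _ C) => //.
by apply: measurable_flow_fun => //; exact: bounded_lipschitz_continuous.
Qed.

Lemma semigroupB f x y t : bounded_lipschitz f -> 0 <= t ->
  semigroup b Sigma P W t f x - semigroup b Sigma P W t f y =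
  \int[P]_w (f (Z x t w) - f (Z y t w)).
Proof.
by move=> fbl t0; rewrite RintegralB//; exact: integrable_flow_fun.
Qed.

Hypothesis grad_semigroup : forall f, bounded_lipschitz f -> forall t : R, 0 <= t ->
  (grad_norm_sup M (semigroup b Sigma P W t f)
     <= (expR (- rho * t))%:E * grad_norm_sup M f)%E.

(* The contraction of Lipschitz norms, applied to the truncations of the
   (unbounded) linear form [u . M x]. *)
Lemma mean_displacement_le u x y t : 0 <= t ->
  \int[P]_w dot u (M *m (Z x t w - Z y t w)) <=
  expR (- rho * t) * normM M u * normM M (x - y).
Proof.
(* [grad_norm_sup] only controls pairs of distinct points. *)
move=> t0; have [->|xy] := eqVneq x y.
  under eq_Rintegral do rewrite subrr mulmx0 dot0r.
  by rewrite Rintegral_cst// mul0r !mulr_ge0 ?expR_ge0 ?normM_ge0.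
pose l a := dot u (M *m a).
have lB a c : l a - l c = l (a - c) by rewrite /l mulmxBr dotBr.
have [K K0 HK] := normM_le_normr M.
(* Truncation does not increase increments, so by Cauchy-Schwarz every truncated form has Lipschitz
   constant [||u||_M] for [distM], whatever [n]. *)
have fl n a c : `|clamp n (l a) - clamp n (l c)| <= normM M u * distM M a c.
  by rewrite (le_trans (clamp_lipschitz _ _ _))// lB normr_dotM_le.
have fbl n : bounded_lipschitz (fun a => clamp n (l a)).
  split; first by exists n%:R => a; exact: clamp_bound.
  exists (normM M u * K) => a c; rewrite (le_trans (fl n a c))//.
  by rewrite -mulrA ler_wpM2l ?normM_ge0// HK.
have cl : continuous l.
  by apply: continuous_dot; [exact: cst_continuous|exact: continuous_mulmx].
have Hn n : \int[P]_w (clamp n (l (Z x t w)) - clamp n (l (Z y t w))) <=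
    expR (- rho * t) * normM M u * normM M (x - y).
  rewrite -(semigroupB x y (fbl n) t0).
  apply: (le_trans (ler_norm _)).
  apply: (grad_norm_sup_leP M_pd) => //.
  apply: (le_trans (grad_semigroup (fbl n) t0)).
  rewrite EFinM lee_pmul2l ?lte_fin ?expR_gt0//.
  by apply: (grad_norm_sup_le M_pd) => a c _; exact: fl.
have [kappa Hk] := flow_dist_bound.
have lim : \int[P]_w (clamp n (l (Z x t w)) - clamp n (l (Z y t w))) @[n --> \oo]
    --> \int[P]_w l (Z x t w - Z y t w).
  apply: (@Rintegral_bounded_cvg _ _ _ P _ _ (normM M u * (expR (kappa * t) * normM M (x - y)))).
  - move=> n; apply: measurable_funB;
      by apply: (measurable_flow_fun (h := fun a => clamp n (l a))) => //;
        exact: bounded_lipschitz_continuous.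
  - move=> n w; rewrite (le_trans (fl _ _ _))// ler_wpM2l ?normM_ge0//.
    exact: Hk.
  - by move=> w; rewrite -lB; apply: cvgB; exact: clamp_cvg.
rewrite -(cvg_lim _ lim)//; apply: limr_le; first exact: (cvgP _ lim).
exact: nearW.
Qed.

(** The noise cancels, and the displacement is a difference of two primitives. [C] multiplies the
    Lipschitz constant, the norm equivalence constant and the largest growth of the [M]-distance on
    [[0, 1]]; it does not depend on [w], as bounded convergence requires. *)
Lemma flow_displacement x y : exists C : R, forall w,
  (forall t, 0 <= t <= 1 ->
    forall i, `|(Z x t w - Z y t w) i 0 - (x - y) i 0| <= C * t) /\
  (forall i, n.+1%:R * ((Z x n.+1%:R^-1 w - Z y n.+1%:R^-1 w) i 0 - (x - y) i 0)
    @[n --> \oo] --> (b x - b y) i 0).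
Proof.
have [kappa Hk] := flow_dist_bound; have [C0 C00 HC0] := normr_le_normM M_pd.
exists (L * (C0 * (expR `|kappa| * normM M (x - y)))) => w.
have [y1 [cy1 yx1 y1E]] := solves_continuous (flow_solves Sigma b_cont L0 b_lip (@W_cont w) x).
have [y2 [cy2 yx2 y2E]] := solves_continuous (flow_solves Sigma b_cont L0 b_lip (@W_cont w) y).
pose g1 i s := b (y1 s) i 0; pose g2 i s := b (y2 s) i 0.
have cg1 i : continuous (g1 i) by exact: continuous_drift_path.
have cg2 i : continuous (g2 i) by exact: continuous_drift_path.
have E t i : 0 <= t -> (Z x t w - Z y t w) i 0 - (x - y) i 0 = prim (g1 i) t - prim (g2 i) t.
  by move=> t0; rewrite /Z -yx1// -yx2// y1E// y2E// !mxE; ring.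
have y0 z Y : (forall t, 0 <= t -> Y t = z + (\col_i prim (fun s => b (Y s) i 0) t)
      + Sigma *m (W t w - W 0 w)) -> Y 0 = z.
  move=> YE; rewrite YE// subrr mulmx0 addr0; apply/colP => i.
  by rewrite !mxE prim0 addr0.
split=> [t /andP[t0 t1] i|i].
  rewrite E//; have := @prim_dist_le _ (g1 i) (g2 i)
    (fun s => L * (C0 * (expR `|kappa| * normM M (x - y))) * s)
    (cst (L * (C0 * (expR `|kappa| * normM M (x - y))))) t t0 (cg1 i) (cg2 i).
  rewrite mulr0 subr0; apply.
    by move=> s; apply: is_derive_eq; rewrite /GRing.scale/= mulr1.
  move=> s s0 st; rewrite (le_trans (normr_coordB _ _ _))// (le_trans (b_lip _ _))//.
  rewrite ler_pM2l// (le_trans (HC0 _))// ler_pM2l// yx1 ?yx2 ?(ltW s0)//.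
  rewrite (le_trans (Hk _ _ _ _ (ltW s0)))// ler_wpM2r ?normM_ge0// ler_expR.
  rewrite (@le_trans _ _ (`|kappa| * s))//.
    by rewrite ler_wpM2r ?ler_norm// ltW.
  by rewrite ler_piMr// (le_trans (ltW st)).
have -> : (b x - b y) i 0 = g1 i 0 - g2 i 0.
  by rewrite /g1 /g2 (y0 x y1 y1E) (y0 y y2 y2E) !mxE.
under eq_fun do rewrite E// mulrBr.
by apply: cvgB; exact: prim_mean_cvg.
Qed.

(** [q n] is the difference quotient of [u . M (Z x - Z y)] between the times 0 and [h = 1/(n+1)].
    Its mean tends to the left-hand side by bounded convergence, and is at most
    [||u||_M^2 (e^(-rho h) - 1) / h]. *)
Lemma drift_dissipative x y :
  dot (x - y) (M *m (b x - b y)) <= - rho * normM M (x - y) ^+ 2.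
Proof.
set u := x - y; pose c := M^T *m u.
have lE a : dot u (M *m a) = \sum_i c i 0 * a i 0.
  by rewrite -dotE /dot trmx_mul trmxK mulmxA.
have [C HC] := flow_displacement x y.
pose h n : R := n.+1%:R^-1.
have h0 n : 0 <= h n by rewrite invr_ge0.
have h1 n : h n <= 1 by rewrite invf_le1 ?ler1n.
pose q n w := n.+1%:R * (dot u (M *m (Z x (h n) w - Z y (h n) w)) - dot u (M *m u)).
have qE n w : q n w = \sum_i c i 0 *
    (n.+1%:R * ((Z x (h n) w - Z y (h n) w) i 0 - u i 0)).
  rewrite /q !lE -sumrB mulr_sumr; apply: eq_bigr => i _.
  by rewrite -mulrBr mulrCA.
have mq n : measurable_fun setT (fun w => dot u (M *m (Z x (h n) w - Z y (h n) w))).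
  apply: (measurable_borel_comp (h := fun a => dot u (M *m a))).
    by apply: continuous_dot; [exact: cst_continuous|exact: continuous_mulmx].
  by apply: measurable_borelB;
    exact: (measurable_flow_path Sigma b_cont L0 b_lip W_meas W_cont).
have [kappa Hk] := flow_dist_bound.
have lim : \int[P]_w q n w @[n --> \oo] --> dot u (M *m (b x - b y)).
  have -> : dot u (M *m (b x - b y)) = \int[P]_(w in setT) dot u (M *m (b x - b y)).
    by rewrite Rintegral_probability_cst.
  apply: (@Rintegral_bounded_cvg _ _ _ P _ _ (\sum_i `|c i 0| * C)).
  - by move=> n; apply: measurable_funM => //; apply: measurable_funB.
  - move=> n w; rewrite qE (le_trans (ler_norm_sum _ _ _))// ler_sum// => i _.
    rewrite normrM ler_wpM2l// normrM ger0_norm// mulrC -ler_pdivlMr ?ltr0n//.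
    by apply: (HC w).1; rewrite h0 h1.
  - move=> w; under eq_fun do rewrite qE; rewrite lE.
    by apply: cvg_sumr => i; apply: cvgM; [exact: cvg_cst|exact: (HC w).2].
have Hq n : \int[P]_w q n w <= normM M u ^+ 2 * (- rho * expR (- rho * h n)).
  have iq : P.-integrable setT (EFin \o (fun w => dot u (M *m (Z x (h n) w - Z y (h n) w)))).
    apply: (@bounded_integrable _ _ _ _ _ (normM M u * (expR (kappa * h n) * normM M u))) => // w.
    by rewrite (le_trans (normr_dotM_le M_pd _ _))// ler_wpM2l ?normM_ge0// Hk.
  have ic : P.-integrable setT (EFin \o (fun w => dot u (M *m u))).
    exact: (@bounded_integrable _ _ _ _ _ `|dot u (M *m u)|).
  rewrite RintegralZl//; last first.
    by rewrite (_ : EFin \o _ = (EFin \o (fun w => dot u (M *m (Z x (h n) w - Z y (h n) w))))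
      \- (EFin \o (fun w => dot u (M *m u))))%E//; exact: integrableB.
  rewrite RintegralB// Rintegral_probability_cst.
  rewrite -(sqr_normM M_pd) mulrC -ler_pdivlMr ?ltr0n//.
  have := mean_displacement_le u x y (h0 n); rewrite -/u => H.
  rewrite -/(h n); set e := expR _ in H *.
  (* This is [1 + rho h <= e^(rho h)] multiplied by [e = e^(-rho h)]; it spares differentiating the
     exponential. *)
  have : e - 1 <= - rho * h n * e.
    have := expR_ge1Dx (- (- rho * h n)); rewrite expRN -/e => He.
    have e0 : 0 < e by exact: expR_gt0.
    by rewrite -(ler_pM2r e0) mulVf ?gt_eqF// in He; lra.
  move=> /(ler_wpM2l (sqr_ge0 (normM M u))); move: H; rewrite -!mulrA -expr2.
  by set N := normM M u; nra.
have limR : normM M u ^+ 2 * (- rho * expR (- rho * h n)) @[n --> \oo]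
    --> normM M u ^+ 2 * (- rho * expR (- rho * 0)).
  apply: cvgM; first exact: cvg_cst; apply: cvgM; first exact: cvg_cst.
  apply: (@cvg_comp _ _ _ (fun n => - rho * h n) expR _ (nbhs (- rho * 0))).
    by apply: cvgM; [exact: cvg_cst|exact: cvg_harmonic].
  exact: continuous_expR.
rewrite mulr0 expR0 mulr1 mulrC in limR.
by apply: (ler_cvg_to lim limR); exact: nearW.
Qed.

End dissipativity.

(** * Wasserstein distances *)

Section image_measures.
Context {R : realType} {d1 d2 : measure_display}
  {T1 : measurableType d1} {T2 : measurableType d2}.

Lemma image_probability (mu : probability T1 R) (phi : T1 -> T2) :
  measurable_fun setT phi ->
  exists Q : probability T2 R, forall A, Q A = mu (phi @^-1` A).
Proof.
move=> mphi; pose X : {mfun T1 >-> T2} :=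
  HB.pack phi (isMeasurableFun.Build _ _ _ _ phi mphi).
by exists (distribution mu X).
Qed.

Variables (mu : {measure set T1 -> \bar R}) (phi : T1 -> T2).
Hypothesis mphi : measurable_fun setT phi.
Variable nu : {measure set T2 -> \bar R}.
Hypothesis nuE : forall A, measurable A -> nu A = mu (phi @^-1` A).

Lemma ge0_integral_image (h : T2 -> \bar R) : measurable_fun setT h ->
  (forall y, (0 <= h y)%E) -> (\int[nu]_y h y = \int[mu]_x h (phi x))%E.
Proof.
move=> mh h0; rewrite -[RHS]/(\int[mu]_(x in phi @^-1` setT) (h \o phi) x)%E.
rewrite -(ge0_integral_pushforward mphi)//.
by apply: eq_measure_integral => A mA _; rewrite nuE.
Qed.

Lemma Rintegral_image (h : T2 -> R) : measurable_fun setT h ->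
  mu.-integrable setT (EFin \o (h \o phi)) ->
  \int[nu]_y h y = \int[mu]_x h (phi x).
Proof.
move=> mh ih; rewrite /Rintegral; congr fine.
rewrite -[RHS]/(\int[mu]_(x in phi @^-1` setT) ((EFin \o h) \o phi) x)%E.
rewrite -(integral_pushforward mphi)//; last exact/measurable_EFinP.
by apply: eq_measure_integral => A mA _; rewrite nuE.
Qed.

End image_measures.

Section mean_bounds.
Context {R : realType} {dT : measure_display} {T : measurableType dT}.
Variable P : probability T R.

Lemma le_Rintegral_integral (h : T -> R) (C : R) : measurable_fun setT h ->
  (forall w, `|h w| <= C) ->
  ((`|\int[P]_w h w|)%:E <= \int[P]_w (`|h w|)%:E)%E.
Proof.
move=> mh hC; have ih := bounded_integrable P mh hC.
have := le_abse_integral P measurableT (measurable_int _ ih).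
by rewrite -[X in (`|X| <= _)%E]fineK ?integrable_fin_num.
Qed.

Lemma integral_probability_cst (c : \bar R) : (\int[P]_w (cst c) w = c)%E.
Proof.
by rewrite integral_cst//= [X in (_ * X)%E]probability_setT mule1.
Qed.

Lemma ae_Rintegral_le (h : T -> R) (C C' : R) : measurable_fun setT h ->
  (forall w, `|h w| <= C) -> 0 <= C' -> {ae P, forall w, `|h w| <= C'} ->
  `|\int[P]_w h w| <= C'.
Proof.
move=> mh hC C'0 haC; rewrite -lee_fin (le_trans (le_Rintegral_integral mh hC))//.
rewrite -[leRHS]integral_probability_cst; apply: ae_ge0_le_integral => //.
- by apply/measurable_EFinP; exact: measurableT_comp.
- by apply: filterS haC => w hw _; rewrite lee_fin.
Qed.

(** Lets both exponents be treated at once: lower bounds on a transport cost are proved for exponent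
    1, upper bounds for [+oo]. *)
Lemma Lnorm1_le_infty (g : T -> \bar R) : measurable_fun setT g ->
  (Lnorm P 1 g <= Lnorm P +oo g)%E.
Proof.
move=> mg; rewrite Lnorm1 unlock/= [X in if (0 < X)%E then _ else _]probability_setT.
rewrite lte01 -[leRHS]integral_probability_cst; apply: ae_ge0_le_integral => //.
- exact: measurableT_comp.
- move=> w _; apply: ess_sup_gee.
    by rewrite [X in (_ < X)%E]probability_setT lte01.
  by apply: aeW => x; exact: abse_ge0.
- by apply: filterS (ess_sup_ge P (abse \o g)) => w hw _; exact: hw.
Qed.

End mean_bounds.

Section wasserstein_bounds.
Context {R : realType} {d : nat}.
Variables (M : 'M[R]_d) (M_pd : sym_posdef M).

Lemma measurable_distM :
  measurable_fun setT (fun zy : borel R d * borel R d => distM M zy.1 zy.2).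
Proof.
apply: (measurable_borel_comp (h := normM M)); first exact: continuous_normM.
by apply: measurable_borelB; [exact: measurable_fst|exact: measurable_snd].
Qed.

Let distME (zy : borel R d * borel R d) := (distM M zy.1 zy.2)%:E.

Lemma measurable_distME :
  measurable_fun setT distME.
Proof. by apply/measurable_EFinP; exact: measurable_distM. Qed.

(** The easy half of Kantorovich duality: under a coupling, the difference of the means is the mean
    of [f x - f y]. [nu'] and [mu'] repackage as probabilities the values of [law_at], which are
    bare set functions. *)
Lemma coupling_mean_le (nu mu : set (borel R d) -> \bar R)
    (nu' mu' : probability (borel R d) R) (r : \bar R) (f : 'cV[R]_d -> R) (K : R) :
  r = 1%E \/ r = +oo%E ->
  (forall A, measurable A -> nu' A = nu A) ->
  (forall A, measurable A -> mu' A = mu A) ->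
  bounded_lipschitz f -> 0 <= K ->
  (forall x y, x != y -> `|f x - f y| <= K * distM M x y) ->
  ((`|\int[nu']_x f x - \int[mu']_x f x|)%:E <= K%:E * wasserstein M r nu mu)%E.
Proof.
move=> r1 nuE muE fbl K0 fK; have [[C fC] _] := fbl.
have cf := bounded_lipschitz_continuous fbl.
have mf := continuous_measurable_borel cf.
suff H (pi : probability (borel R d * borel R d)%type R) : couplings nu mu pi ->
    ((`|\int[nu']_x f x - \int[mu']_x f x|)%:E <=
      K%:E * Lnorm pi r distME)%E.
  (* Moving [K] to the other side needs [K > 0]; for [K = 0] the function is constant and the two
     means agree. *)
  move: K0; rewrite le_eqVlt => /predU1P[K0|K0].
    have -> : \int[nu']_x f x - \int[mu']_x f x = 0.
      have fcst x y : f x = f y.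
        have [->//|xy] := eqVneq x y.
        have := fK x y xy; rewrite -K0 mul0r normr_le0 subr_eq0 => /eqP //.
      rewrite (@eq_Rintegral _ _ _ nu' _ (fun _ => f 0)); last by move=> x _; exact: fcst.
      rewrite (@eq_Rintegral _ _ _ mu' _ (fun _ => f 0)); last by move=> x _; exact: fcst.
      by rewrite !Rintegral_probability_cst subrr.
    by rewrite normr0 -K0 mul0e.
  rewrite -lee_pdivrMl//; apply: le_ereal_inf_tmp => _ [pi cpi <-].
  by rewrite lee_pdivrMl//; exact: H.
move=> cpi; have m1 := @measurable_fst _ _ (borel R d) (borel R d).
have m2 := @measurable_snd _ _ (borel R d) (borel R d).
have mf1 : measurable_fun setT (fun zy : borel R d * borel R d => f zy.1).
  exact: measurableT_comp mf m1.
have mf2 : measurable_fun setT (fun zy : borel R d * borel R d => f zy.2).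
  exact: measurableT_comp mf m2.
have i1 := bounded_integrable pi mf1 (fun zy => fC zy.1).
have i2 := bounded_integrable pi mf2 (fun zy => fC zy.2).
have E1 A : measurable A -> nu' A = pi (fst @^-1` A).
  move=> mA; rewrite nuE// -(proj1 (cpi A mA)); congr (pi _).
  by apply/seteqP; split=> [[a c] []|[a c]].
have E2 A : measurable A -> mu' A = pi (snd @^-1` A).
  move=> mA; rewrite muE// -(proj2 (cpi A mA)); congr (pi _).
  by apply/seteqP; split=> [[a c] []|[a c]].
rewrite (Rintegral_image m1 E1 mf i1) (Rintegral_image m2 E2 mf i2).
rewrite -RintegralB//.
have fB (zy : borel R d * borel R d) : `|f zy.1 - f zy.2| <= C + C.
  by rewrite (le_trans (ler_normB _ _))// lerD.
rewrite (le_trans (le_Rintegral_integral pi (measurable_funB mf1 mf2) fB))//.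
apply: (@le_trans _ _ (K%:E * Lnorm pi 1 distME)%E); last first.
  rewrite lee_wpmul2l ?lee_fin//; case: r1 => ->//.
  exact: (Lnorm1_le_infty pi measurable_distME).
rewrite Lnorm1; under [in leRHS]eq_integral do rewrite gee0_abs ?lee_fin ?normM_ge0//.
rewrite -ge0_integralZl//; last 2 first.
- exact: measurable_distME.
- by move=> zy _; rewrite lee_fin normM_ge0.
apply: ge0_le_integral => //.
- by apply/measurable_EFinP; apply: measurableT_comp => //; exact: measurable_funB.
- by apply: measurable_funeM; exact: measurable_distME.
- move=> [x y] _ /=; rewrite -EFinM lee_fin.
  have [->|xy] := eqVneq x y; last exact: fK.
  by rewrite subrr normr0 mulr_ge0// normM_ge0.
Qed.

Lemma wasserstein_dirac_le (r : \bar R) (x y : borel R d) :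
  r = 1%E \/ r = +oo%E ->
  (wasserstein M r (dirac x : set (borel R d) -> \bar R) (dirac y) <= (distM M x y)%:E)%E.
Proof.
move=> r1; pose pi : probability (borel R d * borel R d)%type R :=
  [the probability _ _ of dirac (x, y)].
have cpi : couplings (dirac x : set (borel R d) -> \bar R) (dirac y) pi.
  by move=> A mA; rewrite /pi/= !diracE; split; congr (_%:R%:E); congr nat_of_bool;
    apply/idP/idP; rewrite !inE => // -[].
apply: (@le_trans _ _ (Lnorm pi r distME)).
  by apply: ereal_inf_lbound; exists pi.
apply: (@le_trans _ _ (Lnorm pi +oo distME)).
  by case: r1 => ->//; exact: (Lnorm1_le_infty pi measurable_distME).
rewrite unlock/=; case: ifPn => _; last by rewrite lee_fin normM_ge0.
apply/ess_supP/ae_le_measureP.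
  by apply: measurableT_comp => //; exact: measurable_distME.
rewrite /pi/= diracE memNset//= in_itv/= andbT ger0_norm ?normM_ge0//.
by rewrite ltxx.
Qed.
End wasserstein_bounds.

(** * Laws at time [t] and their Wasserstein distances *)

Section laws.
Context {R : realType} {d : nat}.
Variables (b : 'cV[R]_d -> 'cV[R]_d) (Sigma : 'M[R]_d) (b_cont : continuous b).
Variable L : R.
Hypotheses (L0 : 0 < L)
  (b_lip : forall x y : 'cV[R]_d, `|b x - b y| <= L * `|x - y|).
Context {dO : measure_display} {Omega : measurableType dO}.
Variables (P : probability Omega R) (W : R -> Omega -> 'cV[R]_d).
Hypotheses (W_meas : forall t : R, 0 <= t ->
    measurable_fun [set: Omega] (W t : Omega -> borel R d))
  (W_cont : forall w, {within `[0, +oo[, continuous (fun t => W t w)}).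
Variables (M : 'M[R]_d) (M_pd : sym_posdef M) (d_gt0 : (0 < d)%N).
Variables (t : R) (t0 : 0 <= t) (c : R) (c0 : 0 < c).

Let Z z w := flow b Sigma (W ^~ w) z t.

Let mflow : measurable_fun setT (fun zw : borel R d * Omega => Z zw.1 zw.2 : borel R d).
Proof. exact: (measurable_flow Sigma b_cont L0 b_lip W_meas W_cont). Qed.

Let mZ z : measurable_fun setT (Z z : Omega -> borel R d).
Proof. exact: (measurable_flow_path Sigma b_cont L0 b_lip W_meas W_cont). Qed.

Lemma law_at_dirac (x : borel R d) A : measurable A ->
  law_at b Sigma P W (dirac x) t A = P (Z x @^-1` A).
Proof.
move=> mA; rewrite /law_at /pushforward /product_measure1.
set B := _ @^-1` A.
have mB : measurable (B : set (borel R d * Omega)).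
  by rewrite -[B]setTI; exact: mflow.
rewrite integral_dirac//; last exact: measurable_fun_xsection.
rewrite diracT mul1e/=; congr (P _).
by apply/seteqP; split=> w; rewrite /xsection /B /= inE.
Qed.

(** [P_t f(x)] is the mean of [f] under the law started from a Dirac mass at [x]. Duality bounds an
    increment of [P_t f] by the distance between two such laws, and Dirac masses are no further
    apart than their points. *)
Lemma lipschitz_semigroup_of_wasserstein (r : \bar R) : r = 1%E \/ r = +oo%E ->
  (forall (nu mu : probability (borel R d) R),
    (wasserstein M r (law_at b Sigma P W nu t) (law_at b Sigma P W mu t)
      <= c%:E * wasserstein M r nu mu)%E) ->
  forall f, bounded_lipschitz f ->
    (grad_norm_sup M (semigroup b Sigma P W t f) <= c%:E * grad_norm_sup M f)%E.
Proof.
move=> r1 Hw f fbl; have [K K0 KE] := bounded_lipschitz_grad_norm_sup M_pd d_gt0 fbl.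
have fK := grad_norm_sup_leP M_pd (eq_ind _ (fun u => u <= K%:E)%E (lexx _) _ (esym KE)).
rewrite KE -EFinM; apply: (grad_norm_sup_le M_pd) => x y _.
have [Qx QxE] := image_probability P (mZ x).
have [Qy QyE] := image_probability P (mZ y).
have cf := bounded_lipschitz_continuous fbl.
have mf := continuous_measurable_borel cf.
have sE z (Q : probability (borel R d) R) : (forall A, Q A = P (Z z @^-1` A)) ->
    semigroup b Sigma P W t f z = \int[Q]_x f x.
  move=> QE; rewrite (@Rintegral_image _ _ _ _ _ P _ (mZ z) Q (fun A _ => QE A))//.
  exact: (integrable_flow_fun Sigma b_cont L0 b_lip P W_meas W_cont).
rewrite (sE x Qx QxE) (sE y Qy QyE) -lee_fin.
apply: (le_trans (@coupling_mean_le _ _ M (law_at b Sigma P W (dirac (x : borel R d)) t)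
  (law_at b Sigma P W (dirac (y : borel R d)) t) Qx Qy r f K r1 _ _ fbl K0 fK)).
- by move=> A mA; rewrite QxE law_at_dirac.
- by move=> A mA; rewrite QyE law_at_dirac.
rewrite -mulrA mulrCA [leRHS]EFinM lee_wpmul2l ?lee_fin//.
apply: (le_trans (Hw (dirac (x : borel R d)) (dirac (y : borel R d)))).
by rewrite EFinM lee_wpmul2l ?lee_fin ?(ltW c0)//; exact: wasserstein_dirac_le.
Qed.

Lemma lipschitz_semigroup_of_ae :
  (forall x y, {ae P, forall w, normM M (Z x w - Z y w) <= c * normM M (x - y)}) ->
  forall f, bounded_lipschitz f ->
    (grad_norm_sup M (semigroup b Sigma P W t f) <= c%:E * grad_norm_sup M f)%E.
Proof.
move=> Hae f fbl; have [K K0 KE] := bounded_lipschitz_grad_norm_sup M_pd d_gt0 fbl.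
have fK := grad_norm_sup_leP M_pd (eq_ind _ (fun u => u <= K%:E)%E (lexx _) _ (esym KE)).
rewrite KE -EFinM; apply: (grad_norm_sup_le M_pd) => x y _.
rewrite (semigroupB Sigma b_cont L0 b_lip P W_meas W_cont)//.
have cf := bounded_lipschitz_continuous fbl.
have [[C fC] _] := fbl.
apply: (@ae_Rintegral_le _ _ _ _ _ (C + C)).
- by apply: measurable_funB; exact: (measurable_flow_fun Sigma b_cont L0 b_lip W_meas W_cont).
- by move=> w; rewrite (le_trans (ler_normB _ _))// lerD.
- by rewrite !mulr_ge0 ?(ltW c0)// normM_ge0.
- apply: filterS (Hae x y) => w H.
  have [E|ZZ] := eqVneq (Z x w) (Z y w).
    by rewrite -/(Z x w) -/(Z y w) E subrr normr0 !mulr_ge0 ?(ltW c0)// normM_ge0.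
  by rewrite (le_trans (fK _ _ ZZ))// -mulrA mulrCA ler_wpM2l.
Qed.

Hypothesis flow_contraction : forall x y w,
  normM M (Z x w - Z y w) <= c * normM M (x - y).

Let distME (zy : borel R d * borel R d) := (distM M zy.1 zy.2)%:E.

Let Phi (v : (borel R d * borel R d) * Omega) : borel R d * borel R d :=
  (Z v.1.1 v.2, Z v.1.2 v.2).

Let mPhi : measurable_fun setT Phi.
Proof.
apply: measurable_fun_pair.
  apply: (measurableT_comp mflow (g := fun v : (borel R d * borel R d) * Omega => (v.1.1, v.2))).
  apply: measurable_fun_pair; last exact: measurable_snd.
  exact: (measurableT_comp measurable_fst measurable_fst).
apply: (measurableT_comp mflow (g := fun v : (borel R d * borel R d) * Omega => (v.1.2, v.2))).
apply: measurable_fun_pair; last exact: measurable_snd.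
exact: (measurableT_comp measurable_snd measurable_fst).
Qed.

(* Running both marginals of a coupling with the same noise couples the laws at
   time [t]. *)
Lemma wasserstein_flow (r : \bar R) (nu mu : probability (borel R d) R) :
  r = 1%E \/ r = +oo%E ->
  (wasserstein M r (law_at b Sigma P W nu t) (law_at b Sigma P W mu t)
      <= c%:E * wasserstein M r nu mu)%E.
Proof.
move=> r1; rewrite -lee_pdivrMl//; apply: le_ereal_inf_tmp => _ [pi cpi <-].
rewrite lee_pdivrMl//.
have [Q QE] := image_probability (pi \x P)%E mPhi.
(* If [lam] is the image of [pi] by [phi], the flow started at [phi] under [pi] and the noise has
   the law of the flow started from [lam]. It is used for both projections. *)
have section_law (phi : borel R d * borel R d -> borel R d)
    (lam : probability (borel R d) R) (A : set (borel R d)) :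
    measurable_fun setT phi -> (forall B, measurable B -> lam B = pi (phi @^-1` B)) ->
    measurable A ->
    (pi \x P)%E [set v | A (Z (phi v.1) v.2)] = law_at b Sigma P W lam t A.
  move=> mphi lamE mA; rewrite /law_at /pushforward /product_measure1.
  set B := _ @^-1` A.
  have mB : measurable (B : set (borel R d * Omega)) by rewrite -[B]setTI; exact: mflow.
  by rewrite (ge0_integral_image mphi lamE)//; last exact: measurable_fun_xsection.
have pi1 B : measurable B -> nu B = pi (fst @^-1` B).
  move=> mB; rewrite -(proj1 (cpi B mB)); congr (pi _).
  by apply/seteqP; split=> [[u v] []|[u v]].
have pi2 B : measurable B -> mu B = pi (snd @^-1` B).
  move=> mB; rewrite -(proj2 (cpi B mB)); congr (pi _).
  by apply/seteqP; split=> [[u v] []|[u v]].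
have cQ : couplings (law_at b Sigma P W nu t) (law_at b Sigma P W mu t) Q.
  move=> A mA; rewrite !QE.
  rewrite -(section_law _ _ _ measurable_fst pi1 mA).
  rewrite -(section_law _ _ _ measurable_snd pi2 mA).
  by split; congr ((_ \x _)%E _); apply/seteqP; split=> v //= [].
apply: (@le_trans _ _ (Lnorm Q r distME)).
  by apply: ereal_inf_lbound; exists Q.
have mD := measurable_distME M.
have mDPhi : measurable_fun setT (fun v => (distM M (Phi v).1 (Phi v).2)%:E).
  exact: (measurableT_comp mD mPhi).
have D0 (zy : borel R d * borel R d) : (0 <= (distM M zy.1 zy.2)%:E)%E.
  by rewrite lee_fin normM_ge0.
have QE' A : measurable A -> Q A = (pi \x P)%E (Phi @^-1` A) by move=> _; exact: QE.
case: r1 => ->.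
  rewrite !Lnorm1 /distME.
  under eq_integral do rewrite gee0_abs//.
  under [in leRHS]eq_integral do rewrite gee0_abs//.
  rewrite (ge0_integral_image mPhi QE')//.
  (* The noise is integrated first: for a fixed starting pair [u] the integrand is at most [c] times
     the distance of [u], and [P] has mass 1. *)
  rewrite (fubini_tonelli1 (fun v => (distM M (Phi v).1 (Phi v).2)%:E))//.
  rewrite -ge0_integralZl ?lee_fin ?(ltW c0)//.
  apply: ge0_le_integral => //.
  - by move=> u _; apply: integral_ge0.
  - exact: (measurable_fun_fubini_tonelli_F (fun v => (distM M (Phi v).1 (Phi v).2)%:E)).
  - by apply: measurable_funeM.
  - move=> u _; rewrite -[leRHS](integral_probability_cst P).
    apply: ge0_le_integral => //=.
    + by move=> w _; rewrite lee_fin normM_ge0.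
    + have mu2 : measurable_fun setT (fun w : Omega => (u, w)) by exact: measurable_fun_pair.
      exact: (measurableT_comp mDPhi mu2).
    + by move=> w _; rewrite -EFinM lee_fin; exact: flow_contraction.
rewrite unlock [X in if (0 < X)%E then _ else _]probability_setT lte01.
rewrite [X in (_ <= _ * (if (0 < X)%E then _ else _))%E]probability_setT lte01.
set D := distME.
have mabsD : measurable_fun setT (abse \o D) by exact: measurableT_comp.
apply/ess_supP/(ae_le_measureP _ _ mabsD).
set K := ess_sup pi _; apply: (etrans (QE _)); set S := Phi @^-1` _.
have mS : measurable S.
  rewrite -[S]setTI; apply: mPhi => //; rewrite -[X in measurable X]setTI.
  by apply: mabsD => //; exact: emeasurable_itv.
(* [S] is the event that the final distance exceeds [c K]. Outside a [pi]-null set of starting pairs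
   the initial distance is at most [K], and then the section of [S] is empty by contraction. *)
change (\int[pi]_x (P \o xsection S) x = 0)%E.
rewrite (ae_eq_integral (cst 0%E)) ?integral0//.
  exact: measurable_fun_xsection.
apply: filterS (ess_sup_ge pi (abse \o D)) => u uK _ /=.
rewrite (_ : xsection S u = set0) ?measure0//; apply/seteqP; split=> // w.
rewrite /xsection /S /= inE /= in_itv/= andbT ltNge => /negP; apply.
apply: (@le_trans _ _ (c%:E * `|D u|)%E).
  rewrite /D /distME !gee0_abs// -EFinM lee_fin ger0_norm ?normM_ge0//.
  exact: flow_contraction.
by rewrite lee_wpmul2l ?lee_fin ?(ltW c0).
Qed.

End laws.

(** * Pointwise gradients *)

(** Let [sg] be the supremum of the [s] in [[0, 1]] with [|phi s - phi 0| <= c s]. The local bound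
    at [sg], used to the left, shows that [sg] has this property; used to the right, it contradicts
    [sg < 1]. *)
Lemma local_lipschitz_increment {R : realType} (phi : R -> R) (c : R) :
  (forall s, 0 <= s <= 1 -> exists2 r, 0 < r & forall s', 0 <= s' <= 1 ->
     `|s - s'| <= r -> `|phi s - phi s'| <= c * `|s - s'|) ->
  `|phi 1 - phi 0| <= c.
Proof.
move=> Hloc; pose A := [set s : R | 0 <= s <= 1 /\ `|phi s - phi 0| <= c * s].
have A0 : A 0 by split; rewrite ?lexx ?ler01// subrr normr0 mulr0.
have hsA : has_sup A by split; [exists 0|exists 1 => s [/andP[]]].
set sg := sup A.
have sg0 : 0 <= sg by apply: ub_le_sup => //; exact: hsA.2.
have sg1 : sg <= 1 by apply: ge_sup; [exists 0|move=> s [/andP[]]].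
have [r r0 Hr] := Hloc sg (introT andP (conj sg0 sg1)).
have [a [/andP[a0 a1] Aa] sa] := sup_adherent r0 hsA.
have asg : a <= sg by apply: ub_le_sup; [exact: hsA.2|split => //; rewrite a0 a1].
have Asg : `|phi sg - phi 0| <= c * sg.
  have := Hr a; rewrite a0 a1 ger0_norm ?subr_ge0// => /(_ isT) H.
  have {}H : `|phi sg - phi a| <= c * (sg - a) by apply: H; rewrite -/sg in sa; lra.
  by have := ler_distD (phi a) (phi sg) (phi 0); lra.
have [sg1'|sg1'] := ltP sg 1; last first.
  have sg_eq1 : sg = 1 by lra.
  by move: Asg; rewrite sg_eq1 mulr1.
pose s' := Num.min (sg + r) 1.
have s'sg : sg < s' by rewrite lt_min sg1' andbT ltrDl.
have s'1 : s' <= 1 by rewrite ge_min lexx orbT.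
have s'r : s' <= sg + r by rewrite ge_min lexx.
have s'0 : 0 <= s' by rewrite (le_trans sg0)// ltW.
have : s' <= sg.
  apply: ub_le_sup; first exact: hsA.2.
  split; first by rewrite s'0 s'1.
  have := Hr s'; rewrite s'0 s'1 distrC ger0_norm ?subr_ge0 ?(ltW s'sg)// => /(_ isT) H.
  have {}H : `|phi sg - phi s'| <= c * (s' - sg) by apply: H; lra.
  by rewrite distrC in H; have := ler_distD (phi sg) (phi s') (phi 0); lra.
by rewrite leNgt s'sg.
Qed.

Section local_slopes.
Context {R : realType} {d : nat}.
Variables (M : 'M[R]_d) (M_pd : sym_posdef M).
Implicit Types (f g : 'cV[R]_d -> R) (x y z : 'cV[R]_d) (r : R).
Local Open Scope ereal_scope.

Definition ball_slope f r z : \bar R :=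
  ereal_sup [set slope M f z y | y in [set y | (0 < distM M z y <= r)%R]].

Lemma ball_slope_nondecreasing f z : {homo ball_slope f ^~ z : r s / (r <= s)%R >-> r <= s}.
Proof.
move=> r s rs; apply: ereal_sup_le => _ [y /= /andP[y0 yr] <-].
by exists y => //=; rewrite y0 (le_trans yr).
Qed.

Lemma cvg_ball_slope f z : ball_slope f r z @[r --> 0^'+] -->
  ereal_inf [set ball_slope f r z | r in `]0%R, +oo[].
Proof.
by apply: nondecreasing_at_right_cvge => // r s _ _; exact: ball_slope_nondecreasing.
Qed.

(** The suprema decrease with the radius, so their limit is an infimum: any number above it bounds
    all slopes in some ball. *)
Lemma grad_normE f z :
  grad_norm M f z = ereal_inf [set ball_slope f r z | r in `]0%R, +oo[].
Proof. by apply/cvg_lim => //; exact: cvg_ball_slope. Qed.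

Lemma grad_norm_le_ball_slope f z r : (0 < r)%R -> grad_norm M f z <= ball_slope f r z.
Proof.
move=> r0; rewrite grad_normE; apply: ereal_inf_lbound.
by exists r => //=; rewrite in_itv/= r0.
Qed.

Lemma ball_slope_leP f r z (K : R) : ball_slope f r z <= K%:E ->
  forall y, (distM M z y <= r)%R -> (`|f z - f y| <= K * distM M z y)%R.
Proof.
move=> fK y yr; have [->|zy] := eqVneq z y.
  rewrite subrr normr0 /distM subrr (_ : normM M 0 = 0%R) ?mulr0//.
  by apply/eqP; rewrite normM_eq0.
rewrite -ler_pdivrMr ?distM_gt0// (distMC M) -lee_fin; apply: le_trans fK.
apply: ereal_sup_ubound; exists y => //=.
by rewrite distM_gt0// zy.
Qed.

Lemma ball_slope_le f r z (K : \bar R) : 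
  (forall y, (0 < distM M z y <= r)%R -> slope M f z y <= K) ->
  ball_slope f r z <= K.
Proof. by move=> fK; apply: ge_ereal_sup => _ [y yr <-]; exact: fK. Qed.

(** An empty supremum would be [-oo]; in positive dimension the point [y] below lies at distance
    exactly [r]. *)
Lemma ball_slope_ge0 f r z : (0 < d)%N -> (0 < r)%R -> 0 <= ball_slope f r z.
Proof.
move=> d0 r0; have u0 : (const_mx 1%R : 'cV[R]_d) != 0%R.
  apply/eqP => /matrixP /(_ (Ordinal d0) 0%R); rewrite !mxE => /eqP.
  by rewrite oner_eq0.
have nu := u0; rewrite -(normM_gt0 M_pd) in nu.
pose y := (z - (r / normM M (const_mx 1%R)) *: (const_mx 1%R : 'cV[R]_d))%R.
have zy : distM M z y = r.
  rewrite /distM /y opprB addrCA subrr addr0 normMZ ger0_norm ?divr_ge0// ?ltW//.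
  by rewrite mulfVK// gt_eqF.
apply: (@le_trans _ _ (slope M f z y)).
  by rewrite lee_fin divr_ge0// normM_ge0.
by apply: ereal_sup_ubound; exists y => //=; rewrite zy r0 lexx.
Qed.

Lemma ball_slope_le_sup f r z : ball_slope f r z <= grad_norm_sup M f.
Proof.
apply: ball_slope_le => y /andP[zy _]; apply: ereal_sup_ubound.
by exists (z, y) => //=; rewrite -(distM_gt0 M_pd).
Qed.

Lemma grad_norm_ge0 f z : (0 < d)%N -> 0 <= grad_norm M f z.
Proof.
move=> d0; rewrite grad_normE; apply: le_ereal_inf_tmp => _ [r /= + <-].
by rewrite in_itv/= andbT; exact: ball_slope_ge0.
Qed.

Lemma grad_norm_le_sup f z : grad_norm M f z <= grad_norm_sup M f.
Proof. exact: le_trans (grad_norm_le_ball_slope f z ltr01) (ball_slope_le_sup _ _ _). Qed.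

(** Along the segment from [y] to [x] the [M]-distance is proportional to the parameter, which
    reduces the claim to one variable. The slack [e] is needed because a bound on the limiting slope
    holds on a whole ball only for larger constants. *)
Lemma grad_norm_sup_le_local g (K : R) :
  (forall z, grad_norm M g z <= K%:E) -> grad_norm_sup M g <= K%:E.
Proof.
move=> gK; apply: (grad_norm_sup_le M_pd) => x y xy.
have xy0 : (0 < distM M x y)%R by rewrite distM_gt0.
rewrite -ler_pdivrMr//; apply/ler_addgt0Pr => e e0; rewrite ler_pdivrMr//.
pose p (s : R) := (y + s *: (x - y))%R.
have px : p 1%R = x by rewrite /p scale1r addrCA subrr addr0.
have py : p 0%R = y by rewrite /p scale0r addr0.
rewrite -{1}px -{1}py; apply: (local_lipschitz_increment (phi := g \o p)) => s _.
have pd s' : distM M (p s) (p s') = (`|s - s'| * distM M x y)%R.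
  by rewrite /distM -normMZ /p opprD addrACA subrr add0r -scalerBl.
have : grad_norm M g (p s) < (K + e)%:E.
  by rewrite (le_lt_trans (gK _))// lte_fin ltrDl.
rewrite grad_normE => /ereal_inf_lt[_ [r /= + <-]].
rewrite in_itv/= andbT => r0 /ltW /ball_slope_leP Hr.
exists (r / distM M x y)%R; first by rewrite divr_gt0.
move=> s' _; rewrite ler_pdivlMr// -pd => /Hr /=.
by rewrite pd mulrCA mulrC.
Qed.

Lemma open_slope_gt f (u : 'cV[R]_d) (a : R) : continuous f ->
  open [set z | a%:E < slope M f z (z + u)%R].
Proof.
move=> cf; pose h z := (`|f z - f (z + u)| / normM M u)%R.
have ch : continuous h.
  have ct : continuous (fun z : 'cV[R]_d => z + u)%R.
    by move=> z; apply: continuousD; [exact: cvg_id|exact: cst_continuous].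
  have cB : continuous (fun z => f z - f (z + u))%R.
    move=> z; apply: continuousB; first exact: cf.
    by apply: (@continuous_comp _ _ _ (fun z => z + u)%R f); [exact: ct|exact: cf].
  move=> z; apply: (@continuousM R 'cV[R]_d (fun z => `|f z - f (z + u)|%R)
    (cst (normM M u)^-1%R)); last exact: cst_continuous.
  exact: (cvg_norm (cB z)).
rewrite (_ : [set z | _] = h @^-1` `]a, +oo[).
  by have /continuousP := ch; apply; exact: interval_open.
by apply/seteqP; split=> z /=; rewrite in_itv/= andbT lte_fin /h /distM addrAC subrr add0r.
Qed.

(** The supremum is over uncountably many slopes. Indexed by the increment [u = y - z], they range
    over a set independent of [z] and each is continuous in [z]; superlevel sets are then unions of
    open sets. *)
Lemma measurable_ball_slope f r : continuous f ->
  measurable_fun setT (ball_slope f r : borel R d -> \bar R).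
Proof.
move=> cf; apply: (measurability _ (ErealGenOInfty.measurableE R)).
move=> _ [_ [a ->] <-]; rewrite setTI; apply: sub_sigma_algebra.
rewrite (_ : _ @^-1` _ = \bigcup_(u in [set u : 'cV[R]_d | (0 < normM M u <= r)%R])
    [set z | a%:E < slope M f z (z + u)%R]).
  by apply: bigcup_open => u _; exact: open_slope_gt.
have zu z u : distM M z (z + u)%R = normM M u.
  by rewrite /distM opprD addrA subrr add0r normMN.
apply/seteqP; split=> z /=; rewrite in_itv/= andbT.
  move=> /ereal_sup_gt[_ [y /= yr <-]] ay; exists (y - z)%R; last first.
    by rewrite /= addrCA subrr addr0.
  by rewrite /= -(zu z) addrCA subrr addr0.
move=> [u /= ur au]; apply: (lt_le_trans au); apply: ereal_sup_ubound.
by exists (z + u)%R => //=; rewrite zu.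
Qed.

End local_slopes.

Section gradient_of_lipschitz.
Context {R : realType} {d : nat}.
Variables (M : 'M[R]_d) (M_pd : sym_posdef M) (d_gt0 : (0 < d)%N).
Variables (f : 'cV[R]_d -> R) (f_bl : bounded_lipschitz f).

Lemma grad_norm_fin_num z : grad_norm M f z \is a fin_num.
Proof.
have [K K0 KE] := bounded_lipschitz_grad_norm_sup M_pd d_gt0 f_bl.
rewrite ge0_fin_numE; last exact: grad_norm_ge0.
by rewrite (le_lt_trans (grad_norm_le_sup M_pd f z))// KE ltry.
Qed.

Lemma cvg_ball_slope_harmonic z :
  (ball_slope M f n.+1%:R^-1 z @[n --> \oo] --> grad_norm M f z)%E.
Proof.
have H := @cvg_ball_slope _ _ M f z; rewrite -grad_normE in H.
rewrite -(fineK (grad_norm_fin_num z)) in H *.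
move/cvge_at_rightP : H; apply; split=> [n|]; first by rewrite invr_gt0.
exact: cvg_harmonic.
Qed.

Lemma measurable_grad_norm : measurable_fun setT (grad_norm M f : borel R d -> \bar R).
Proof.
apply: (emeasurable_fun_cvg (fun n => ball_slope M f n.+1%:R^-1 : borel R d -> \bar R)).
  by move=> n; apply: measurable_ball_slope; exact: bounded_lipschitz_continuous.
by move=> z _; exact: cvg_ball_slope_harmonic.
Qed.

End gradient_of_lipschitz.

(** * The pointwise gradient bound for the semigroup *)

Section gradient_estimate.
Context {R : realType} {d : nat}.
Variables (b : 'cV[R]_d -> 'cV[R]_d) (Sigma : 'M[R]_d) (b_cont : continuous b).
Variable L : R.
Hypotheses (L0 : 0 < L)
  (b_lip : forall x y : 'cV[R]_d, `|b x - b y| <= L * `|x - y|).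
Context {dO : measure_display} {Omega : measurableType dO}.
Variables (P : probability Omega R) (W : R -> Omega -> 'cV[R]_d).
Hypotheses (W_meas : forall t : R, 0 <= t ->
    measurable_fun [set: Omega] (W t : Omega -> borel R d))
  (W_cont : forall w, {within `[0, +oo[, continuous (fun t => W t w)}).
Variables (M : 'M[R]_d) (M_pd : sym_posdef M) (d_gt0 : (0 < d)%N).
Variables (t : R) (t0 : 0 <= t) (c : R) (c0 : 0 < c).

Let Z z w := flow b Sigma (W ^~ w) z t.

Let mZ z : measurable_fun setT (Z z : Omega -> borel R d).
Proof. exact: (measurable_flow_path Sigma b_cont L0 b_lip W_meas W_cont). Qed.

Variables (f : 'cV[R]_d -> R) (f_bl : bounded_lipschitz f).

Lemma grad_norm_sup_of_grad_norm :
  (forall z, grad_norm M (semigroup b Sigma P W t f) z <=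
     c%:E * semigroup_ereal b Sigma P W t (grad_norm M f) z)%E ->
  (grad_norm_sup M (semigroup b Sigma P W t f) <= c%:E * grad_norm_sup M f)%E.
Proof.
move=> H; have [K K0 KE] := bounded_lipschitz_grad_norm_sup M_pd d_gt0 f_bl.
rewrite KE -EFinM; apply: (grad_norm_sup_le_local M_pd) => z.
apply: (le_trans (H z)); rewrite EFinM lee_wpmul2l ?lee_fin ?(ltW c0)//.
rewrite -[leRHS](integral_probability_cst P); apply: ge0_le_integral => //.
- by move=> w _; exact: grad_norm_ge0.
- exact: (measurableT_comp (measurable_grad_norm M_pd d_gt0 f_bl) (mZ z)).
- by move=> w _; rewrite -KE; exact: grad_norm_le_sup.
Qed.

Hypothesis flow_contraction : forall x y w,
  normM M (Z x w - Z y w) <= c * normM M (x - y).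

Let mball (r : R) z : measurable_fun setT (fun w => ball_slope M f r (Z z w)).
Proof.
have cf := bounded_lipschitz_continuous f_bl.
exact: (measurableT_comp (measurable_ball_slope M r cf) (mZ z)).
Qed.

(** Points within [r] of [z] are carried within [c r] of the image of [z] for every noise, so all
    slopes of [P_t f] at [z] are bounded by one mean that does not involve [y]. *)
Lemma ball_slope_semigroup (r : R) z : 0 < r ->
  (ball_slope M (semigroup b Sigma P W t f) r z <=
    c%:E * \int[P]_w ball_slope M f (c * r) (Z z w))%E.
Proof.
move=> r0; apply: ball_slope_le => y /andP[zy0 zyr].
have cr0 : 0 < c * r by rewrite mulr_gt0.
have cf := bounded_lipschitz_continuous f_bl; have [[C fC] _] := f_bl.
have zy0' : 0 < distM M y z by rewrite (distMC M).
have [K K0 KE] := bounded_lipschitz_grad_norm_sup M_pd d_gt0 f_bl.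
rewrite /slope mulrC EFinM lee_pdivrMl// muleA -EFinM.
rewrite (semigroupB Sigma b_cont L0 b_lip P W_meas W_cont)//.
have mfZ x : measurable_fun setT (fun w => f (Z x w)).
  exact: (measurable_flow_fun Sigma b_cont L0 b_lip W_meas W_cont).
have mB : measurable_fun setT (fun w => f (Z z w) - f (Z y w)) by exact: measurable_funB.
apply: (le_trans (le_Rintegral_integral P mB (C := C + C) _)).
  by move=> w; rewrite (le_trans (ler_normB _ _))// lerD.
have cd0 : 0 <= distM M y z * c by rewrite mulr_ge0// ltW.
rewrite -ge0_integralZl//; last first.
  by move=> w _; exact: ball_slope_ge0.
apply: ge0_le_integral => //.
- by apply/measurable_EFinP; exact: measurableT_comp.
- exact: measurable_funeM.
move=> w _.
have s0 : (0 <= ball_slope M f (c * r) (Z z w))%E by exact: ball_slope_ge0.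
have sK : (ball_slope M f (c * r) (Z z w) <= K%:E)%E by rewrite -KE; exact: ball_slope_le_sup.
have sfin : ball_slope M f (c * r) (Z z w) \is a fin_num.
  by rewrite ge0_fin_numE// (le_lt_trans sK)// ltry.
rewrite -(fineK sfin) -EFinM lee_fin.
have Zzy : distM M (Z z w) (Z y w) <= c * distM M z y by exact: flow_contraction.
have := @ball_slope_leP _ _ M M_pd f (c * r) (Z z w) (fine (ball_slope M f (c * r) (Z z w))).
rewrite fineK// => /(_ (lexx _) (Z y w)) H.
rewrite (le_trans (H _))//.
  by rewrite (le_trans Zzy)// ler_pM2l.
by rewrite [leRHS]mulrC ler_wpM2l ?fine_ge0// (distMC M y z) [leRHS]mulrC.
Qed.

Lemma gradient_estimate z :
  (grad_norm M (semigroup b Sigma P W t f) z <=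
     c%:E * semigroup_ereal b Sigma P W t (grad_norm M f) z)%E.
Proof.
have [K K0 KE] := bounded_lipschitz_grad_norm_sup M_pd d_gt0 f_bl.
(* With this radius [c * r n] is [1/(n+1)], the sequence along which the slopes of [f] converge; the
   global constant [K] dominates them. *)
pose r n : R := c^-1 * n.+1%:R^-1.
have H n : (grad_norm M (semigroup b Sigma P W t f) z <=
    c%:E * \int[P]_w ball_slope M f n.+1%:R^-1 (Z z w))%E.
  have rn0 : 0 < r n by rewrite mulr_gt0 ?invr_gt0.
  apply: (le_trans (grad_norm_le_ball_slope M _ z rn0)).
  by have := ball_slope_semigroup z rn0; rewrite /r mulrA mulfV ?gt_eqF// mul1r.
have lim : (\int[P]_w ball_slope M f n.+1%:R^-1 (Z z w) @[n --> \oo] -->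
    \int[P]_w grad_norm M f (Z z w))%E.
  have iK : P.-integrable setT (EFin \o cst K).
    exact: (@bounded_integrable _ _ _ _ _ `|K|).
  have := @dominated_convergence _ _ R P setT measurableT
    (fun n w => ball_slope M f n.+1%:R^-1 (Z z w)) (fun w => grad_norm M f (Z z w))
    (EFin \o cst K).
  case => //.
  - exact: (measurableT_comp (measurable_grad_norm M_pd d_gt0 f_bl) (mZ z)).
  - by apply: aeW => w _; exact: cvg_ball_slope_harmonic.
  - apply: aeW => w n _; rewrite gee0_abs; last by apply: ball_slope_ge0 => //; rewrite invr_gt0.
    by rewrite /= -KE; exact: ball_slope_le_sup.
have limc := cvgeZl (isT : c%:E \is a fin_num) lim.
rewrite -(cvg_lim _ limc)//; apply: lime_ge; first exact: (cvgP _ limc).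
exact: nearW.
Qed.

End gradient_estimate.

(** * Equivalence *)

Theorem theorem1 (R : realType) (d : nat) (d_gt0 : (0 < d)%N)
  (b : 'cV[R]_d -> 'cV[R]_d) (b_smooth : smooth b)
  (b_bounded : bounded_derivatives b)
  (Sigma : 'M[R]_d) (Sigma_psd : sym_possemidef Sigma)
  (dO : measure_display) (Omega : measurableType dO)
  (P : probability Omega R) (W : R -> Omega -> 'cV[R]_d)
  (W_brownian : brownian_motion P W)
  (M : 'M[R]_d) (M_pd : sym_posdef M) (rho : R) :
  [<->
    (* (i) *)
    forall z : 'cV[R]_d, mx_le (M *m Jac b z) (- rho *: M);
    (* (ii) *)
    forall (z1 z2 : 'cV[R]_d) (Z1 Z2 : R -> Omega -> 'cV[R]_d),
      sde_solution b Sigma P W z1 Z1 -> sde_solution b Sigma P W z2 Z2 ->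
      {ae P, forall w, forall t : R, 0 <= t ->
         normM M (Z1 t w - Z2 t w) <= expR (- rho * t) * normM M (z1 - z2)};
    (* (iii) *)
    forall (nu mu : probability (borel R d) R) (t : R), 0 <= t ->
      (wasserstein M +oo (law_at b Sigma P W nu t) (law_at b Sigma P W mu t)
         <= (expR (- rho * t))%:E * wasserstein M +oo nu mu)%E;
    (* (iv) *)
    forall (nu mu : probability (borel R d) R) (t : R), 0 <= t ->
      (wasserstein M 1 (law_at b Sigma P W nu t) (law_at b Sigma P W mu t)
         <= (expR (- rho * t))%:E * wasserstein M 1 nu mu)%E;
    (* (v) *)
    forall (f : 'cV[R]_d -> R), bounded_lipschitz f ->
      forall (t : R) (z : 'cV[R]_d), 0 <= t ->
      (grad_norm M (semigroup b Sigma P W t f) z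
         <= (expR (- rho * t))%:E
            * semigroup_ereal b Sigma P W t (grad_norm M f) z)%E;
    (* (vi) *)
    forall (f : 'cV[R]_d -> R), bounded_lipschitz f ->
      forall t : R, 0 <= t ->
      (grad_norm_sup M (semigroup b Sigma P W t f)
         <= (expR (- rho * t))%:E * grad_norm_sup M f)%E ].
Proof.
have [L L0 b_lip] := drift_lipschitz b_smooth b_bounded.
have b_cont := drift_continuous b_smooth.
have [W_meas _ W_cont _ _] := W_brownian.
have c0 t : 0 < expR (- rho * t) by exact: expR_gt0.
(* Stated for any two solutions and not only for [flow], because (ii) quantifies over all of
   them. *)
have contraction : (forall z : 'cV[R]_d, mx_le (M *m Jac b z) (- rho *: M)) ->
    forall w z1 z2 x1 x2 t, solves b Sigma (W ^~ w) z1 x1 ->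
      solves b Sigma (W ^~ w) z2 x2 -> 0 <= t ->
      normM M (x1 t - x2 t) <= expR (- rho * t) * normM M (z1 - z2).
  move=> /(jacobian_dissipative b_smooth M_pd rho).1 Hb w z1 z2 x1 x2 t s1 s2 t0.
  exact: (solves_contraction b_cont M_pd Hb s1 s2 t0).
have flow_sol w z := flow_solves Sigma b_cont L0 b_lip (@W_cont w) z.
have flow_contraction (Hi : forall z : 'cV[R]_d, mx_le (M *m Jac b z) (- rho *: M))
    t (t0 : 0 <= t) x y w :
    normM M (flow b Sigma (W ^~ w) x t - flow b Sigma (W ^~ w) y t) <=
    expR (- rho * t) * normM M (x - y).
  exact: (contraction Hi w _ _ _ _ t (flow_sol w x) (flow_sol w y) t0).
have dissipative : (forall f : 'cV[R]_d -> R, bounded_lipschitz f ->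
      forall t : R, 0 <= t -> (grad_norm_sup M (semigroup b Sigma P W t f)
         <= (expR (- rho * t))%:E * grad_norm_sup M f)%E) ->
    forall z : 'cV[R]_d, mx_le (M *m Jac b z) (- rho *: M).
  move=> Hvi; apply/(jacobian_dissipative b_smooth M_pd rho) => x y.
  exact: (drift_dissipative b_cont L0 b_lip W_meas W_cont M_pd Hvi).
have law_contraction (r : \bar R) : r = 1%E \/ r = +oo%E ->
    (forall z : 'cV[R]_d, mx_le (M *m Jac b z) (- rho *: M)) ->
    forall (nu mu : probability (borel R d) R) (t : R), 0 <= t ->
      (wasserstein M r (law_at b Sigma P W nu t) (law_at b Sigma P W mu t)
         <= (expR (- rho * t))%:E * wasserstein M r nu mu)%E.
  move=> r1 Hi nu mu t t0.
  apply: (wasserstein_flow b_cont L0 b_lip P W_meas W_cont t0 (c0 t)) => // x y w.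
  exact: flow_contraction.
have of_law_contraction (r : \bar R) : r = 1%E \/ r = +oo%E ->
    (forall (nu mu : probability (borel R d) R) (t : R), 0 <= t ->
      (wasserstein M r (law_at b Sigma P W nu t) (law_at b Sigma P W mu t)
         <= (expR (- rho * t))%:E * wasserstein M r nu mu)%E) ->
    forall z : 'cV[R]_d, mx_le (M *m Jac b z) (- rho *: M).
  move=> r1 H; apply: dissipative => f fbl t t0.
  apply: (lipschitz_semigroup_of_wasserstein b_cont L0 b_lip W_meas W_cont M_pd
    d_gt0 t0 (c0 t) r1) => //.
  by move=> nu mu; exact: H.
(* From each of (ii), (iii) and (iv) the proof first returns to (i) through (vi), then gets the next
   item from the pathwise contraction. No measurable selection of couplings is needed this way. *)
tfae.
- move=> Hi z1 z2 Z1 Z2 [_ S1] [_ S2].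
  by apply: filterS2 S1 S2 => w s1 s2 t t0; exact: (contraction Hi w _ _ _ _ t s1 s2 t0).
- move=> Hii; apply: law_contraction; first by right.
  apply: dissipative => f fbl t t0.
  apply: (lipschitz_semigroup_of_ae b_cont L0 b_lip W_meas W_cont M_pd d_gt0 t0 (c0 t)) => // x y.
  (* [flow] is itself a solution of the equation, so (ii) applies to it. *)
  have sol z : sde_solution b Sigma P W z (fun s w => flow b Sigma (W ^~ w) z s).
    split=> [s s0|]; last by apply: aeW => w; exact: flow_sol.
    exact: (measurable_flow_path Sigma b_cont L0 b_lip W_meas W_cont).
  by apply: filterS (Hii x y _ _ (sol x) (sol y)) => w; exact.
- move=> /of_law_contraction Hi; apply: law_contraction; first by left.
  by apply: Hi; right.
- move=> /of_law_contraction Hi f fbl t z t0.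
  apply: (gradient_estimate b_cont L0 b_lip P W_meas W_cont M_pd d_gt0 t0 (c0 t)) => //.
  by apply: flow_contraction => //; apply: Hi; left.
- move=> Hv f fbl t t0.
  apply: (grad_norm_sup_of_grad_norm b_cont L0 b_lip W_meas W_cont M_pd d_gt0 t0 (c0 t)) => // z.
  exact: Hv.
- exact: dissipative.
Qed.
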